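(* Let $T>0$, $d\in\mathbb{N}$, $x_0\in\mathbb{R}^d$, let $\pi$ be a partition of $[0,T]$, let $0\le\alpha'<\alpha\le1$, $\beta>0$, $\gamma\ge1$, let $\Lambda^\pi_T$ carry the metric $d_{\Lambda,\alpha'}$, and let $$\psi\colon\Lambda_T^\pi\to(0,\infty),\qquad\psi(\widehat X^\pi_{[0,t]}):=\exp\bigl(\beta\|\widehat X^{\pi,t}\|_\alpha^\gamma\bigr).$$ Then the linear span of the set $$\Bigl\{\widehat X^\pi_{[0,t]}\mapsto\langle e_I,\widehat{\mathbb X}^\pi_t\rangle : I\in\{0,\ldots,d\}^N,\ N\in\mathbb{N}_0\Bigr\}$$ is dense in $\mathcal B_\psi(\Lambda_T^\pi)$; that is, for every $f\in\mathcal B_\psi(\Lambda_T^\pi)$ and every $\varepsilon>0$ there exists a linear function $\boldsymbol\ell$ of the form $\boldsymbol\ell(\widehat{\mathbb X}^\pi_t)=\sum_{|I|\le N}\ell_I\langle e_I,\widehat{\mathbb X}^\pi_t\rangle$, with some $N\in\mathbb{N}_0$ and $\ell_I\in\mathbb{R}$, such that $$\sup_{\widehat X^\pi_{[0,t]}\in\Lambda_T^\pi}\frac{|f(\widehat X^\pi_{[0,t]})-\boldsymbol\ell(\widehat{\mathbb X}^\pi_t)|}{\psi(\widehat X^\pi_{[0,t]})}<\varepsilon .$$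
   Context: Path space. Let $\pi=\{0=t_0<\cdots<t_n=T\}$ be a partition of $[0,T]$ and $x_0\in\mathbb{R}^d$ a fixed initial value. For $X\colon\pi\to\mathbb{R}^d$ with $X_0=x_0$, $X^\pi\colon[0,T]\to\mathbb{R}^d$ is its piecewise linear interpolation, $X^\pi_t=X_{t_k}+\frac{t-t_k}{t_{k+1}-t_k}(X_{t_{k+1}}-X_{t_k})$ for $t\in[t_k,t_{k+1}]$, and $\widehat X^\pi_t=(t,X^\pi_t)\in\mathbb{R}^{d+1}$ is the time-extended path. $\widehat{\mathcal C}^\pi$ denotes the set of all such $\widehat X^\pi$. Norms. With $|\cdot|$ the Euclidean norm and $Y_{s,t}:=Y_t-Y_s$, set $\|Y\|_\alpha:=\sup_{0\le s<t\le T}\frac{|Y_{s,t}|}{|t-s|^\alpha}$ and $d_{\alpha'}(Y,Z):=\sup_{0\le s<t\le T}\frac{|Y_{s,t}-Z_{s,t}|}{|t-s|^{\alpha'}}$. Stopped paths. $\Lambda_T^\pi:=\bigcup_{t\in[0,T]}\{\widehat X^\pi_{[0,t]}:\widehat X^\pi\in\widehat{\mathcal C}^\pi\}$, where $\widehat X^\pi_{[0,t]}$ is the restriction of $\widehat X^\pi$ to $[0,t]$. For $\widehat X^\pi_{[0,t]}\in\Lambda_T^\pi$, $\widehat X^{\pi,t}\colon[0,T]\to\mathbb{R}^{d+1}$ is the path $\widehat X^{\pi,t}_u=(u,X^\pi_{u\wedge t})$ (space components stopped at $t$, time component not stopped). The metric is $d_{\Lambda,\alpha'}(\widehat X^\pi_{[0,t]},\widehat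 Y^\pi_{[0,s]}):=|t-s|+d_{\alpha'}(\widehat X^{\pi,t},\widehat Y^{\pi,s})$. Signature. The coordinates of $\mathbb{R}^{d+1}$ are indexed by $0,1,\ldots,d$, with index $0$ the time coordinate, and $e_0,\dots,e_d$ is the canonical basis. For a multi-index $I=(i_1,\ldots,i_k)\in\{0,\ldots,d\}^k$, $|I|=k$ and $e_I=e_{i_1}\otimes\cdots\otimes e_{i_k}$. $\widehat{\mathbb X}^\pi_t$ is the signature of $\widehat X^\pi$ on $[0,t]$, i.e. the element of $T((\mathbb{R}^{d+1}))=\prod_{k\ge0}(\mathbb{R}^{d+1})^{\otimes k}$ with coordinates $\langle e_I,\widehat{\mathbb X}^\pi_t\rangle=\int_{0<u_1<\cdots<u_k<t}d\widehat X^{\pi,i_1}_{u_1}\cdots d\widehat X^{\pi,i_k}_{u_k}$ (Riemann–Stieltjes integrals), and $\langle e_\emptyset,\widehat{\mathbb X}^\pi_t\rangle=1$. Weighted function space. For a completely regular Hausdorff space $E$ and $\psi\colon E\to(0,\infty)$ with $\psi^{-1}((0,R])$ compact for all $R>0$ (an admissible weight function), let $B_\psi(E)=\{f\colon E\to\mathbb{R}:\sup_{x\in E}|f(x)|/\psi(x)<\infty\}$ with norm $\|f\|_{\mathcal B_\psi(E)}=\sup_{x\in E}|f(x)|/\psi(x)$; $\mathcal B_\psi(E)$ is the closure in $B_\psi(E)$, with respect to this norm, of the space $C_b(E)$ of bounded continuous real functions on $E$. *)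

(* Defs.v *)
From HB Require Import structures.
From mathcomp Require Import all_boot all_order all_algebra.
From mathcomp Require Import all_classical all_reals all_analysis.
From mathcomp Require Import ring lra.

Set Implicit Arguments.
Unset Strict Implicit.
Unset Printing Implicit Defensive.

Import Order.TTheory GRing.Theory Num.Theory.
Import numFieldNormedType.Exports.

Local Open Scope classical_set_scope.
Local Open Scope ring_scope.

Section euclidean_norm.
Context {R : realType} {n : nat}.
Implicit Types v w : 'rV[R]_n.

(* The library norm on ['rV_n] is the supremum norm. *)
Definition enorm v : R := Num.sqrt (\sum_i v 0 i ^+ 2).

Lemma enorm_ge0 v : 0 <= enorm v.
Proof. exact: sqrtr_ge0. Qed.

Lemma sqr_enorm v : enorm v ^+ 2 = \sum_i v 0 i ^+ 2.
Proof. by rewrite sqr_sqrtr// sumr_ge0// => i _; exact: sqr_ge0. Qed.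

Lemma enorm0 : enorm 0 = 0.
Proof.
by rewrite /enorm big1 ?sqrtr0// => i _; rewrite mxE expr0n.
Qed.

Lemma enorm0_eq0 v : enorm v = 0 -> v = 0.
Proof.
move=> v0; apply/rowP => i; rewrite mxE.
have : \sum_i v 0 i ^+ 2 == 0 by rewrite -sqr_enorm v0 expr0n.
rewrite psumr_eq0; last by move=> j _; exact: sqr_ge0.
by move/allP/(_ i); rewrite mem_index_enum => /(_ isT); rewrite /= sqrf_eq0 => /eqP.
Qed.

Lemma enormZ (a : R) v : enorm (a *: v) = `|a| * enorm v.
Proof.
rewrite /enorm -sqrtr_sqr -sqrtrM ?sqr_ge0// mulr_sumr.
by congr Num.sqrt; apply: eq_bigr => i _; rewrite mxE exprMn.
Qed.

Lemma enormN v : enorm (- v) = enorm v.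
Proof. by rewrite -scaleN1r enormZ normrN1 mul1r. Qed.

Lemma cauchy_schwarz v w : \sum_i v 0 i * w 0 i <= enorm v * enorm w.
Proof.
have [/eqP/enorm0_eq0 ->|v0] := boolP (enorm v == 0).
  by rewrite enorm0 mul0r big1// => i _; rewrite mxE mul0r.
have [/eqP/enorm0_eq0 ->|w0] := boolP (enorm w == 0).
  by rewrite enorm0 mulr0 big1// => i _; rewrite mxE mulr0.
have vp : 0 < enorm v by rewrite lt_def v0 enorm_ge0.
have wp : 0 < enorm w by rewrite lt_def w0 enorm_ge0.
suff : 0 <= 2 * (enorm v * enorm w) * (enorm v * enorm w - \sum_i v 0 i * w 0 i).
  by rewrite pmulr_rge0 ?mulr_gt0// subr_ge0.
have expand (x y S : R) : 2 * (x * y) * (x * y - S) =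
  y ^+ 2 * x ^+ 2 - 2 * (x * y) * S + x ^+ 2 * y ^+ 2 by ring.
rewrite expand {1}(sqr_enorm v) {2}(sqr_enorm w) !mulr_sumr -sumrB -big_split/=.
rewrite (eq_bigr (fun i => (enorm w * v 0 i - enorm v * w 0 i) ^+ 2)).
  by apply: sumr_ge0 => i _; exact: sqr_ge0.
by move=> i _; ring.
Qed.

Lemma ler_enormD v w : enorm (v + w) <= enorm v + enorm w.
Proof.
rewrite -(@ler_pXn2r _ 2)// ?nnegrE ?addr_ge0 ?enorm_ge0//.
rewrite sqrrD !sqr_enorm.
have -> : \sum_i (v + w) 0 i ^+ 2 =
    \sum_i v 0 i ^+ 2 + (\sum_i v 0 i * w 0 i) *+ 2 + \sum_i w 0 i ^+ 2.
  rewrite -sumrMnl -!big_split/=; apply: eq_bigr => i _.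
  by rewrite mxE sqrrD.
by rewrite lerD2r lerD2l lerMn2r cauchy_schwarz orbT.
Qed.

End euclidean_norm.

Lemma enorm_row_mx {R : realType} {m n : nat} (v : 'rV[R]_m) (w : 'rV[R]_n) :
  enorm (row_mx v w) <= enorm v + enorm w.
Proof.
have -> : row_mx v w = row_mx v 0 + row_mx 0 w by rewrite add_row_mx addr0 add0r.
rewrite (le_trans (ler_enormD _ _))// lerD//.
  rewrite /enorm big_split_ord/= [X in _ + X]big1 ?addr0.
    by under eq_bigr do rewrite row_mxEl.
  by move=> i _; rewrite row_mxEr mxE expr0n.
rewrite /enorm big_split_ord/= [X in X + _]big1 ?add0r.
  by under eq_bigr do rewrite row_mxEr.
by move=> i _; rewrite row_mxEl mxE expr0n.
Qed.

Lemma enorm_scalar {R : realType} (r : R) : enorm (r%:M : 'rV[R]_1) = `|r|.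
Proof. by rewrite /enorm big_ord1 mxE eqxx mulr1n sqrtr_sqr. Qed.

Lemma sup_image_ge0 {R : realType} {I : Type} (S : set I) (f : I -> R) :
  (forall i, S i -> 0 <= f i) -> has_ubound (f @` S) -> 0 <= sup (f @` S).
Proof.
move=> f0 ubf; have [->|/set0P[i Si]] := eqVneq S set0.
  by rewrite image_set0 sup0.
by rewrite (le_trans (f0 _ Si))// ub_le_sup//; exists i.
Qed.

Lemma sup_image_le_add {R : realType} {I : Type} (S : set I) (f g h : I -> R) :
  (forall i, S i -> f i <= g i + h i) ->
  has_ubound (g @` S) -> has_ubound (h @` S) ->
  sup (f @` S) <= sup (g @` S) + sup (h @` S).
Proof.
move=> fgh ubg ubh; have [->|/set0P[i0 Si0]] := eqVneq S set0.
  by rewrite !image_set0 sup0 addr0.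
apply: ge_sup => [|_ [i Si <-]]; first by exists (f i0), i0.
rewrite (le_trans (fgh _ Si))// lerD// ub_le_sup//; by exists i.
Qed.

Section hoelder.
Context {R : realType} {n : nat}.
Implicit Types (T a : R) (Y Z : R -> 'rV[R]_n).

Definition incr Y (s t : R) := Y t - Y s.

Definition simplex T : set (R * R) :=
  [set st | [&& 0 <= st.1, st.1 < st.2 & st.2 <= T]].

(* [sup] is [0] on sets that are not bounded above; the sets below are bounded
   for the stopped paths and for exponents in [[0, 1]], see [hoelder_norm_ubound]
   and [hoelder_dist_ubound]. *)
Definition hoelder_norm T a Y : R :=
  sup [set enorm (incr Y st.1 st.2) / (`|st.2 - st.1| `^ a) | st in simplex T].

Definition hoelder_dist T a Y Z : R :=
  sup [set enorm (incr Y st.1 st.2 - incr Z st.1 st.2) / (`|st.2 - st.1| `^ a)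
      | st in simplex T].

End hoelder.

Section path_space.
Context {R : realType}.

(* The points [t_1 < ... < t_n = T]; the point [t_0 = 0] is implicit, as in
   [itv_partition]. *)
Record time_partition (T : R) := TimePartition {
  points :> seq R ;
  pointsP : itv_partition 0 T points }.

Context {d : nat}.
Implicit Types (X : R -> 'rV[R]_d) (s : seq R).

(* Interpolation of [X] along [a :: s], constant after the last point. Only the
   values of [X] at the points of [a :: s] matter: a function on the partition
   is represented by any of its extensions to [R]. *)
Fixpoint pl_interp X (a : R) s (t : R) : 'rV[R]_d :=
  if s is b :: s' then
    if t <= b then X a + ((t - a) / (b - a)) *: (X b - X a)
    else pl_interp X b s' t
  else X a.

Definition time_extend (Y : R -> 'rV[R]_d) (t : R) : 'rV[R]_(1 + d) :=
  row_mx t%:M (Y t).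

Definition pl_paths T (p : time_partition T) (x0 : 'rV[R]_d) :
    set (R -> 'rV[R]_(1 + d)) :=
  [set time_extend (pl_interp X 0 p) | X in [set X | X 0 = x0]].

(* A path on [[0, t]] is the pair of [t] and of the function extended by [0]
   outside of [[0, t]], so that distinct horizons give distinct elements. *)
Definition stopped_paths T (p : time_partition T) (x0 : 'rV[R]_d) :
    set (R * (R -> 'rV[R]_(1 + d))) :=
  \bigcup_(t in `[0, T]) [set (t, Y \_ `[0, t]) | Y in pl_paths p x0].

Lemma pl_interp_left X (a b : R) s : itv_partition a b s -> pl_interp X a s a = X a.
Proof.
case: s => //= h s [/= /andP[ah _] _].
by rewrite ltW// subrr mul0r scale0r addr0.
Qed.

Lemma pl_interpE X (a b : R) s k t : itv_partition a b s -> (k < size s)%N ->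
  let: u := nth b (a :: s) k in let: v := nth b (a :: s) k.+1 in
  u <= t <= v ->
  pl_interp X a s t = X u + ((t - u) / (v - u)) *: (X v - X u).
Proof.
elim: s a k => // h s IH a [|k] abs ks /=; first by move=> /andP[_ ->].
move=> /andP[ut tv]; have hbs := itv_partition_cons abs.
have hu : h <= nth b (h :: s) k by apply: itv_partition_nth_ge => //; rewrite ltnW.
case: leP => [th|_]; last by apply: IH => //; rewrite ut.
have tu : t = nth b (h :: s) k by apply/eqP; rewrite eq_le ut (le_trans th).
have ht : h = t by apply/eqP; rewrite eq_le th tu hu.
have ah : a < h by case: abs => /= /andP[].
rewrite -tu subrr mul0r scale0r addr0 -ht divff ?scale1r ?subrKC//.
by rewrite subr_eq0 gt_eqF.
Qed.

Lemma pl_interp_lip X (a b : R) s : itv_partition a b s ->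
  exists2 L, 0 <= L & forall u v, a <= u -> u <= v -> v <= b ->
    enorm (pl_interp X a s v - pl_interp X a s u) <= L * (v - u).
Proof.
elim: s a => [|h s IH] a abs.
  by exists 0 => // u v _ _ _; rewrite subrr enorm0 mul0r.
have hbs := itv_partition_cons abs; have [L L0 HL] := IH _ hbs.
have ah : 0 < h - a by case: abs => /= /andP[]; rewrite subr_gt0.
set K := enorm (X h - X a) / (h - a).
have K0 : 0 <= K by rewrite divr_ge0 ?enorm_ge0 ?ltW.
have HK u v : u <= v -> v <= h -> enorm (pl_interp X a (h :: s) v - pl_interp X a (h :: s) u) <= K * (v - u).
  move=> uv vh; rewrite /= vh (le_trans uv vh) opprD addrACA subrr add0r -scalerBl enormZ.
  rewrite -mulrBl opprB addrA subrK ger0_norm; last first.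
    by rewrite divr_ge0 ?subr_ge0// ltW// -subr_gt0.
  suff -> : (v - u) / (h - a) * enorm (X h - X a) = K * (v - u) by [].
  by rewrite /K [LHS]mulrAC [RHS]mulrAC (mulrC (v - u)).
have HL' u v : h < u -> u <= v -> v <= b -> enorm (pl_interp X a (h :: s) v - pl_interp X a (h :: s) u) <= L * (v - u).
  move=> hu uv vb; rewrite /= !ifN -?ltNge// ?(lt_le_trans hu uv)//.
  exact: HL (ltW hu) uv vb.
have hE : pl_interp X a (h :: s) h = X h.
  by rewrite /= lexx divff ?gt_eqF// scale1r subrKC.
exists (K + L) => [|u v au uv vb]; first by rewrite addr_ge0.
have uv0 : 0 <= v - u by rewrite subr_ge0.
have [vh|hv] := leP v h.
  by rewrite (le_trans (HK _ _ uv vh))// ler_wpM2r// lerDl.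
have [uh|hu] := leP u h; last first.
  by rewrite (le_trans (HL' _ _ hu uv vb))// ler_wpM2r// lerDr.
rewrite -(subrK (X h) (pl_interp X a (h :: s) v)) -addrA.
rewrite (le_trans (ler_enormD _ _))// -{2}hE.
apply: (@le_trans _ _ (L * (v - h) + K * (h - u))).
  apply: lerD; last exact: HK.
  have := HL _ _ (lexx h) (ltW hv) vb.
  by rewrite (pl_interp_left _ hbs) /= ifN// -ltNge.
have : 0 <= K * (v - h) by rewrite mulr_ge0// subr_ge0 ltW.
have : 0 <= L * (h - u) by rewrite mulr_ge0// subr_ge0.
lra.
Qed.

(* The exponent only serves to select the metric put on this type below. *)
Definition Lambda T (p : time_partition T) (x0 : 'rV[R]_d) (a : {i01 R}) :=
  set_type (stopped_paths p x0).

HB.instance Definition _ T (p : time_partition T) (x0 : 'rV[R]_d) (a : {i01 R}) :=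
  Choice.copy (Lambda p x0 a) (set_type (stopped_paths p x0)).

End path_space.

Section Lambda_metric.
Context {R : realType} {d : nat} {T : R} {p : time_partition T}
  {x0 : 'rV[R]_d} {a : {i01 R}}.
Implicit Types x y z : Lambda p x0 a.

Definition horizon x : R := (val x).1.
Definition path_of x : R -> 'rV[R]_(1 + d) := (val x).2.

Definition stopped x (u : R) : 'rV[R]_(1 + d) :=
  row_mx u%:M (rsubmx (path_of x (Num.min u (horizon x)))).

Definition dLambda x y : R :=
  `|horizon x - horizon y| + hoelder_dist T a%:num (stopped x) (stopped y).

Lemma LambdaP x : exists X, [/\ 0 <= horizon x <= T, X 0 = x0 &
  path_of x = time_extend (pl_interp X 0 p) \_ `[0, horizon x]].
Proof.
rewrite /horizon /path_of; case: x => -[t Y] /= /set_mem[t' /= t'T [_ [X X0 <-]]].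
by case=> <- <-; exists X; split => //; rewrite in_itv in t'T.
Qed.

Lemma path_ofE x X u :
  path_of x = time_extend (pl_interp X 0 p) \_ `[0, horizon x] ->
  0 <= u <= horizon x -> path_of x u = time_extend (pl_interp X 0 p) u.
Proof. by move=> -> ut; rewrite patchE mem_set//= in_itv. Qed.

Lemma stoppedE x X u : 0 <= horizon x ->
  path_of x = time_extend (pl_interp X 0 p) \_ `[0, horizon x] ->
  0 <= u -> stopped x u = time_extend (pl_interp X 0 p \o Num.min^~ (horizon x)) u.
Proof.
move=> t0 xE u0; rewrite /stopped (path_ofE xE) ?row_mxKr//.
by rewrite le_min u0 t0 ge_min lexx orbT.
Qed.

Lemma stopped0 x : stopped x 0 = row_mx 0 x0.
Proof.
have [X [/andP[t0 _] X0 xE]] := LambdaP x.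
rewrite (stoppedE t0 xE)// /time_extend /= min_l// raddf0.
by rewrite (pl_interp_left X (pointsP p)) X0.
Qed.

Lemma stopped_lip x : exists2 L, 0 <= L & forall u v, 0 <= u -> u <= v -> v <= T ->
  enorm (incr (stopped x) u v) <= L * (v - u).
Proof.
have [X [/andP[t0 tT] X0 xE]] := LambdaP x.
have [L L0 HL] := pl_interp_lip X (pointsP p).
exists (1 + L) => [|u v u0 uv vT]; first by rewrite addr_ge0.
rewrite /incr (stoppedE t0 xE (le_trans u0 uv)) (stoppedE t0 xE u0).
rewrite opp_row_mx add_row_mx (le_trans (enorm_row_mx _ _))// mulrDl mul1r lerD//.
  by rewrite -raddfB/= enorm_scalar ger0_norm// subr_ge0.
rewrite /=; set t := horizon x; set u' := Num.min u t; set v' := Num.min v t.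
have uv' : u' <= v' by rewrite /u' /v' le_min !ge_min uv lexx !orbT.
rewrite (le_trans (HL _ _ _ uv' _))//.
- by rewrite /u' le_min u0.
- by rewrite /v' ge_min vT.
rewrite ler_wpM2l// /u' /v'; clear -uv; case: (leP u t); case: (leP v t); lra.
Qed.

Lemma stopped_bound (b : {i01 R}) x : exists M, forall st, simplex T st ->
  enorm (incr (stopped x) st.1 st.2) / (`|st.2 - st.1| `^ b%:num) <= M.
Proof.
have [L L0 HL] := stopped_lip x.
exists (L * (1 + T)) => -[u v] /and3P[/= u0 uv vT].
have vu0 : 0 < v - u by rewrite subr_gt0.
rewrite gtr0_norm// ler_pdivrMr ?powR_gt0//.
rewrite (le_trans (HL _ _ u0 (ltW uv) vT))// -mulrA ler_wpM2l//.
have T0 : 0 <= T by rewrite (le_trans _ vT)// (le_trans u0)// ltW.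
have b1 : b%:num <= 1 by [].
have {1}-> : v - u = (v - u) `^ (1 - b%:num) * (v - u) `^ b%:num.
  rewrite -powRD; last by apply/implyP => _; rewrite gt_eqF.
  by rewrite subrK powRr1// ltW.
rewrite ler_wpM2r ?powR_ge0//.
rewrite (@le_trans _ _ ((1 + T) `^ (1 - b%:num)))//.
  by apply: ge0_ler_powR; rewrite ?nnegrE ?subr_ge0//; move: u0 uv vT T0; lra.
by rewrite -[leRHS]powRr1 ?addr_ge0// ler_powR ?lerDl.
Qed.

Lemma hoelder_norm_ubound (b : {i01 R}) x : has_ubound
  [set enorm (incr (stopped x) st.1 st.2) / (`|st.2 - st.1| `^ b%:num)
  | st in simplex T].
Proof. by have [M HM] := stopped_bound b x; exists M => _ [st /HM + <-]. Qed.

Lemma hoelder_dist_ubound x y : has_ubound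
  [set enorm (incr (stopped x) st.1 st.2 - incr (stopped y) st.1 st.2)
         / (`|st.2 - st.1| `^ a%:num) | st in simplex T].
Proof.
have [[M HM] [N HN]] := (stopped_bound a x, stopped_bound a y).
exists (M + N) => _ [st stT <-]; rewrite (le_trans _ (lerD (HM _ stT) (HN _ stT)))//.
rewrite -mulrDl ler_wpM2r ?invr_ge0 ?powR_ge0//.
by rewrite (le_trans (ler_enormD _ _))// enormN.
Qed.

Lemma hoelder_dist_ge0 x y : 0 <= hoelder_dist T a%:num (stopped x) (stopped y).
Proof.
apply: sup_image_ge0 (hoelder_dist_ubound x y) => st _.
by rewrite divr_ge0 ?powR_ge0 ?enorm_ge0.
Qed.

Lemma hoelder_dist0 x y u : hoelder_dist T a%:num (stopped x) (stopped y) = 0 ->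
  0 <= u <= T -> stopped x u = stopped y u.
Proof.
move=> d0 /andP[]; rewrite le_eqVlt => /predU1P[<- _|u0 uT].
  by rewrite !stopped0.
have /(ub_le_sup (hoelder_dist_ubound x y)) : 
    [set enorm (incr (stopped x) st.1 st.2 - incr (stopped y) st.1 st.2)
         / (`|st.2 - st.1| `^ a%:num) | st in simplex T]
    (enorm (incr (stopped x) 0 u - incr (stopped y) 0 u) / (`|u - 0| `^ a%:num)).
  by exists (0, u) => //=; apply/and3P.
rewrite [X in _ <= X]d0 pmulr_lle0 ?invr_gt0 ?powR_gt0 ?normr_gt0 ?subr0 ?gt_eqF//.
move=> e0; have /enorm0_eq0 : enorm (incr (stopped x) 0 u - incr (stopped y) 0 u) = 0.
  by apply/eqP; rewrite eq_le e0 enorm_ge0.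
by rewrite /incr !stopped0 opprB addrA subrK => /subr0_eq.
Qed.

Fact dLambdaxx x : dLambda x x = 0.
Proof.
rewrite /dLambda subrr normr0 add0r /hoelder_dist.
under eq_imagel do rewrite subrr enorm0 mul0r.
have [->|/set0P S0] := eqVneq (simplex T) set0; first by rewrite image_set0 sup0.
by rewrite set_cst ifN ?sup1//; apply/set0P.
Qed.

Fact dLambda_positivity x y : dLambda x y = 0 -> x = y.
Proof.
move=> /eqP; rewrite paddr_eq0 ?hoelder_dist_ge0// normr_eq0 subr_eq0.
move=> /andP[/eqP txy /eqP/hoelder_dist0 dxy].
have [X [/andP[t0 tT] X0 xE]] := LambdaP x.
have [Y [_ Y0 yE]] := LambdaP y.
apply: val_inj; rewrite [LHS]surjective_pairing [RHS]surjective_pairing.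
congr pair => //; rewrite -/(path_of x) -/(path_of y).
apply/funext => u; rewrite xE yE -txy !patchE; case: ifPn => // /set_mem /=.
rewrite in_itv/= => /andP[u0 ut].
have := dxy u; rewrite u0 (le_trans ut)// => /(_ isT).
by rewrite (stoppedE t0 xE)// (stoppedE _ yE) -?txy// /time_extend/= min_l.
Qed.

Fact dLambda_sym x y : dLambda x y = dLambda y x.
Proof.
rewrite /dLambda distrC /hoelder_dist; congr (_ + sup _).
by apply: eq_imagel => st _; rewrite -enormN opprB.
Qed.

Fact dLambda_triangle y x z : dLambda x z <= dLambda x y + dLambda y z.
Proof.
rewrite /dLambda addrACA lerD ?ler_distD//.
apply: sup_image_le_add (hoelder_dist_ubound x y) (hoelder_dist_ubound y z) => st stT.
rewrite -mulrDl ler_wpM2r ?invr_ge0 ?powR_ge0//.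
by rewrite (le_trans _ (ler_enormD _ _))// addrA subrK.
Qed.

HB.instance Definition _ := @isMetric.Build R (Lambda p x0 a) dLambda
  dLambdaxx dLambda_positivity dLambda_sym dLambda_triangle.

Lemma Lambda_nbhsP x (U : set (Lambda p x0 a)) :
  nbhs x U <-> exists2 e : R, 0 < e & forall y, dLambda x y < e -> U y.
Proof.
by rewrite -nbhs_ballE; split => -[e e0 xU]; exists e.
Qed.

End Lambda_metric.

(* Riemann-Stieltjes integral: limit of the sums over tagged partitions of
   [[a, b]] as the mesh tends to [0]. *)
Section riemann_stieltjes.
Context {R : realType}.
Implicit Types (f g : R -> R) (a b : R).

Definition is_RS_integral f g a b (l : R) :=
  forall e, 0 < e -> exists2 delta, 0 < delta &
    forall (s : seq R) (xi : nat -> R), itv_partition a b s ->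
    let t := nth b (a :: s) in
    (forall k, (k < size s)%N -> t k <= xi k <= t k.+1) ->
    (forall k, (k < size s)%N -> t k.+1 - t k < delta) ->
    `|\sum_(k < size s) f (xi k) * (g (t k.+1) - g (t k)) - l| < e.

Definition RS_integral f g a b : R := get (is_RS_integral f g a b).

End riemann_stieltjes.

Section signature.
Context {R : realType}.

(* The head of [J] is the letter integrated last. *)
Fixpoint iterated_integral {n : nat} (Y : R -> 'rV[R]_n) (J : seq 'I_n) (t : R) : R :=
  if J is i :: J' then
    RS_integral (iterated_integral Y J') (fun u => Y u 0 i) 0 t
  else 1.

Context {d : nat} {T : R} {p : time_partition T} {x0 : 'rV[R]_d} {a : {i01 R}}.

(* The last letter [i_k] of a multi-index carries the outermost variable [u_k]. *)
Definition sig_coord (I : seq 'I_(1 + d)) (x : Lambda p x0 a) : R :=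
  iterated_integral (path_of x) (rev I) (horizon x).

Definition sig_linear (N : nat) (l : seq 'I_(1 + d) -> R) (x : Lambda p x0 a) : R :=
  \sum_(k < N.+1) \sum_(I : k.-tuple 'I_(1 + d)) l I * sig_coord I x.

Definition exp_weight (alpha beta gamma : R) (x : Lambda p x0 a) : R :=
  expR (beta * hoelder_norm T alpha (stopped x) `^ gamma).

End signature.

Section weighted_space.
Context {R : realType} {E : topologicalType}.
Implicit Types (psi f g : E -> R).

Definition admissible_weight psi :=
  (forall x, 0 < psi x) /\
  (forall r, 0 < r -> compact (psi @^-1` `]0, r])).

Definition weighted_norm psi f : \bar R :=
  ereal_sup (range (fun x => (`|f x| / psi x)%:E)).

(* Closure of the bounded continuous functions for [weighted_norm psi]. *)
Definition weighted_space psi : set (E -> R) :=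
  [set f | (weighted_norm psi f < +oo)%E /\
    forall e, 0 < e -> exists g, [/\ continuous g, bounded_fun g &
      (weighted_norm psi (f \- g)%R < e%:E)%E]].

End weighted_space.

(* Main.v *)
Require Import Defs.
From mathcomp Require Import all_boot all_order all_algebra.
From mathcomp Require Import all_classical all_reals all_analysis.
From mathcomp Require Import ring lra.

Set Implicit Arguments.
Unset Strict Implicit.
Unset Printing Implicit Defensive.

Import Order.TTheory GRing.Theory Num.Theory.
Import numFieldNormedType.Exports.

Local Open Scope classical_set_scope.
Local Open Scope ring_scope.

(** The proof has an abstract and a concrete half.

    The abstract half is a Stone-Weierstrass theorem for weighted norms,
    [weighted_stone_weierstrass]. Let [psi >= 1] have compact sublevel sets and
    let [A] be an algebra of continuous functions that are bounded by multiples
    of [psi]. The bounded continuous [F] such that [F * a] lies in the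
    [psi]-closure of [A] for all [a] in [A] form a uniformly closed algebra, and
    [a = 1] shows that they all lie in that closure. If [|a| * exp (h * |g|)] is
    bounded by a multiple of [psi] for every [a] in [A], then the Taylor
    polynomials of the sine converge in the weighted norm and [sin (k * g)] is
    such a multiplier for small [k]. Hence multipliers separate the points that
    the functions [g] separate, so they approximate a bounded continuous
    function uniformly on a sublevel set of [psi]. Truncating the approximation
    yields another multiplier, and off the sublevel set the error is small
    because [psi] is large there. Only one small [h] per function [g] is needed;
    this is what makes [gamma = 1] accessible for every [beta > 0].

    The concrete half verifies the hypotheses for the signature of stopped
    piecewise linear paths.

    Integration: for Lipschitz [f] and [g], a function [F] is an integral of [f]
    against [g] if and only if [F v - F u = f u * (g v - g u)] up to an error
    [O((v - u)^2)]. Such an [F] is unique up to a constant ([sewing]), computes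
    the Riemann-Stieltjes integral ([primitive_RS]) and exists when [g] is
    piecewise affine. The product rule for such expansions is immediate, and it
    gives the shuffle relation: products of iterated integrals are linear
    combinations of iterated integrals, so that linear functions of the
    signature form an algebra.

    Growth and continuity: the variation of a piecewise affine function is at
    most a constant, depending on the number of its break points, times its
    supremum norm. Applied to a stopped path, this bounds iterated integrals by
    powers of the Hoelder norm; applied to the difference of two stopped paths,
    it shows that iterated integrals are locally Lipschitz for uniform
    convergence, and hence for the metric with any exponent, including [0].

    Separation: the integrals of [q u * (X u - X 0)] over [[0, t]], with [q] a
    polynomial, are linear functions of the signature, grow at most linearly in
    the Hoelder norm, and determine [X] on [[0, t]] by the Weierstrass theorem.

    Compactness: a pointwise limit of stopped paths in a Hoelder ball is again
    affine between the points of the partition up to its horizon and constant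
    after it. The ball is equicontinuous, so pointwise convergence is uniform,
    and the larger exponent [alpha] turns uniform convergence into convergence
    for the smaller exponent. The Hoelder bound is essential: without it the
    path could keep a nonzero increment on a last piece whose length tends
    to [0]. *)

(** * Stone-Weierstrass theorem on a compact set *)

Section abs_approximation.
Context {R : realType}.

(** Newton-type iteration [p := p + (x ^ 2 - p ^ 2) / 2] for the square root of
    [x ^ 2]. *)
Fixpoint abs_poly (n : nat) : {poly R} :=
  if n is m.+1 then abs_poly m + 2^-1 *: ('X ^+ 2 - abs_poly m ^+ 2) else 0.

(** Each step multiplies the error [|x| - p] by [1 - (|x| + p) / 2], hence by at
    most [1 - |x| / 2], and [(1 - y) * (1 + (n + 1) * y) <= 1 + n * y] keeps the
    product in the second claim from increasing. *)
Lemma abs_polyP n (x : R) : `|x| <= 1 ->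
  0 <= (abs_poly n).[x] <= `|x| /\
  (`|x| - (abs_poly n).[x]) * (1 + n%:R * `|x| / 2) <= `|x|.
Proof.
move=> x1; have x0 := normr_ge0 x.
elim: n => [|n [/andP[p0 px] IH]] /=.
  by rewrite horner0 lexx x0 mul0r mul0r addr0 subr0 mulr1.
rewrite !hornerE -(real_normK (num_real x)).
set a := `|x| in x0 x1 px IH *; set p := (abs_poly n).[x] in p0 px IH *.
have -> : p + 2^-1 * (a ^+ 2 - p ^+ 2) = a - (a - p) * (1 - (a + p) / 2) by field.
have h1 : 0 <= 1 - (a + p) / 2 by lra.
have h2 : 1 - (a + p) / 2 <= 1 by lra.
have ap0 : 0 <= a - p by lra.
have h3 : 0 <= (a - p) * (1 - (a + p) / 2) by rewrite mulr_ge0.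
have h4 : (a - p) * (1 - (a + p) / 2) <= a - p by rewrite ler_piMr.
split; first by apply/andP; split; lra.
rewrite opprB addrCA subrr addr0; apply: le_trans IH.
rewrite -mulrA ler_wpM2l//.
have n0 : 0 <= n%:R :> R by [].
have -> : n.+1%:R = n%:R + 1 :> R by rewrite -natr1.
move: n0; set m := n%:R => n0.
have H5 : 0 <= p * (m * a) by rewrite !mulr_ge0.
have H6 : 0 <= p * a by rewrite !mulr_ge0.
have H7 : 0 <= m * a * a by rewrite !mulr_ge0.
have H8 := mulr_ge0 x0 x0.
rewrite -subr_ge0 (_ : _ - _ = p / 2 + m * a * a / 4 + a * a / 4
  + p * (m * a) / 4 + p * a / 4); last by field.
lra.
Qed.

Lemma abs_poly_cvg (e : R) : 0 < e ->
  exists p : {poly R}, forall x, `|x| <= 1 -> `| `|x| - p.[x]| <= e.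
Proof.
move=> e0; pose n := (Num.truncn (2 / e)).+1; exists (abs_poly n) => x x1.
have [/andP[p0 px] H] := abs_polyP n x1.
rewrite ger0_norm ?subr_ge0//; set a := `|x| in x1 px H *; set p := _.[x] in p0 px H *.
have ne : 2 / e < n%:R by rewrite truncnS_gt.
have n0 : 0 < n%:R :> R by rewrite ltr0n.
have [a0|a0] := eqVneq a 0; first by move: px p0; rewrite a0; lra.
have ap : 0 < a by rewrite lt_def a0 /a normr_ge0.
have : (a - p) * (n%:R / 2) <= 1.
  rewrite -(ler_pM2r ap) mul1r; apply: le_trans H.
  rewrite -[leLHS]mulrA ler_wpM2l ?subr_ge0//; lra.
rewrite -ler_pdivlMr; last by rewrite divr_gt0.
move/le_trans; apply; rewrite div1r invf_div ler_pdivrMr// mulrC -ler_pdivrMr//.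
exact: ltW.
Qed.

End abs_approximation.

Section stone_weierstrass.
Context {R : realType} {E : topologicalType}.
Implicit Types (f g : E -> R) (K : set E) (A L : set (E -> R)).

Record function_algebra A : Prop := FunctionAlgebra {
  algebra_cst : forall r : R, A (cst r);
  algebraD : forall f g, A f -> A g -> A (f \+ g);
  algebraM : forall f g, A f -> A g -> A (f \* g) }.

Lemma algebra_horner A f (q : {poly R}) :
  function_algebra A -> A f -> A (fun x => q.[f x]).
Proof.
move=> alg Af; elim/poly_ind: q => [|q c IH].
  rewrite (_ : (fun _ => _) = cst 0); first exact: algebra_cst.
  by apply/funext => x; rewrite horner0.
rewrite (_ : (fun _ => _) = ((fun x => q.[f x]) \* f) \+ cst c).
  by apply: (algebraD alg); [exact: (algebraM alg)|exact: algebra_cst].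
by apply/funext => x; rewrite hornerMXaddC.
Qed.

Lemma algebraZ A f (r : R) : function_algebra A -> A f -> A (fun x => r * f x).
Proof. by move=> alg; exact: algebraM (algebra_cst alg r). Qed.

Lemma compact_fun_bounded K f : compact K -> continuous f ->
  exists2 B, 0 < B & forall x, K x -> `|f x| <= B.
Proof.
move=> cK cf; have : compact (f @` K).
  by apply: continuous_compact => //; exact: continuous_subspaceT.
move=> /compact_bounded[M [_ HM]]; exists (Num.max (M + 1) 1).
  by rewrite lt_max ltr01 orbT.
move=> x Kx; apply: HM; last by exists x.
by rewrite lt_max ltrDl ltr01.
Qed.

(** If no [h] in [L] were below [f] on all of [K], the sets of failure would form
    a filter base, because [L] is stable under minima; a cluster point of it
    contradicts the last hypothesis. *)
Lemma compact_directed_lt K f L : compact K -> continuous f ->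
  L !=set0 -> (forall h, L h -> continuous h) ->
  (forall g h, L g -> L h -> L (fun x => Num.min (g x) (h x))) ->
  (forall x, K x -> exists2 h, L h & h x < f x) ->
  exists2 h, L h & forall x, K x -> h x < f x.
Proof.
move=> cK cf [h0 Lh0] Lc Lmin Lf; apply: contrapT => /forall2NP noh.
pose S h := [set x | K x /\ f x <= h x].
have SN h : L h -> S h !=set0.
  move=> Lh; have [//|/existsNP[x /not_implyP[Kx /negP]]] := noh h.
  by rewrite -leNgt => fh; exists x.
pose F := filter_from L S.
have FF : ProperFilter F.
  apply: filter_from_proper => //; apply: filter_from_filter; first by exists h0.
  move=> g h Lg Lh; exists (fun x => Num.min (g x) (h x)); first exact: (Lmin _ _).
  by move=> x [Kx]; rewrite le_min => /andP[fg fh].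
have FK : F K by exists h0 => // x [].
have [x [Kx cx]] := cK _ FF FK; have [h Lh hx] := Lf x Kx.
have nx : nbhs x [set y | h y - f y < 0].
  have cv : (h \- f) y @[y --> x] --> h x - f x by apply: cvgB; [exact: Lc|exact: cf].
  apply: (cv [set r | r < 0]); apply: open_nbhs_nbhs; split; first exact: open_lt.
  by rewrite /= subr_lt0.
have [y [[_ fhy] /=]] := cx (S h) _ (ex_intro2 _ _ h Lh (fun=> id)) nx.
by rewrite subr_lt0 ltNge fhy.
Qed.

(** The continuous functions that are uniform limits on [K] of elements of [A]
    form a lattice, as [|g|] is a limit of polynomials in [g]. Since [A] takes
    prescribed values at two points, minima produce functions that agree with
    [f] at a point and stay below [f + e], and maxima of these stay above
    [f - e] as well. *)
Lemma stone_weierstrass K A f (e : R) :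
  compact K -> function_algebra A -> (forall a, A a -> continuous a) ->
  (forall x y, K x -> K y -> x <> y -> exists2 a, A a & a x <> a y) ->
  continuous f -> 0 < e ->
  exists2 a, A a & forall x, K x -> `|f x - a x| < e.
Proof.
move=> cK alg Ac sep cf e0.
(* Uniform limits on [K] of elements of [A]. *)
pose L := [set g | continuous g /\
  forall e, 0 < e -> exists2 a, A a & forall x, K x -> `|g x - a x| <= e].
have LA a : A a -> L a.
  move=> Aa; split; first exact: Ac.
  by move=> r r0; exists a => // x _; rewrite subrr normr0 ltW.
have LD g h : L g -> L h -> L (g \+ h).
  move=> [cg Lg] [ch Lh]; split; first by move=> x; apply: cvgD; [exact: cg|exact: ch].
  move=> r r0; have r20 : 0 < r / 2 by rewrite divr_gt0.
  have [a Aa ga] := Lg _ r20; have [b Ab hb] := Lh _ r20.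
  exists (a \+ b); first exact: algebraD.
  move=> x Kx /=; rewrite opprD addrACA (le_trans (ler_normD _ _))//.
  by rewrite (splitr r) lerD ?ga ?hb.
have LZ r g : L g -> L (fun x => r * g x).
  move=> [cg Lg]; split; first by move=> x; apply: cvgMr; exact: cg.
  move=> s s0; have s1 : 0 < s / (`|r| + 1) by rewrite divr_gt0// ltr_wpDl.
  have [a Aa ga] := Lg _ s1; exists (fun x => r * a x); first exact: algebraZ.
  move=> x Kx; rewrite -mulrBr normrM.
  rewrite (@le_trans _ _ (`|r| * (s / (`|r| + 1))))//.
    by rewrite ler_wpM2l// ga.
  by rewrite mulrCA ler_piMr ?(ltW s0)// ler_pdivrMr ?ltr_wpDl// mul1r lerDl.
have Lnorm g : L g -> L (fun x => `|g x|).
  move=> [cg Lg]; split.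
    by move=> x; apply: continuous_comp; [exact: cg|exact: norm_continuous].
  move=> r r0; have r20 : 0 < r / 2 by rewrite divr_gt0.
  have [a Aa ga] := Lg _ r20.
  have [B B0 aB] := compact_fun_bounded cK (Ac _ Aa).
  have [p pP] := @abs_poly_cvg R (r / 2 / B) (divr_gt0 r20 B0).
  exists (fun x => B * p.[B^-1 * a x]).
    by apply: algebraZ => //; apply: algebra_horner => //; exact: algebraZ.
  move=> x Kx; rewrite -(subrK `|a x| `|g x|) -addrA.
  rewrite (le_trans (ler_normD _ _))// (splitr r) lerD//.
    by rewrite (le_trans (ler_dist_dist _ _))// ga.
  have aE : `|a x| = B * `|B^-1 * a x|.
    by rewrite normrM gtr0_norm ?invr_gt0// mulrA divff ?mul1r// gt_eqF.
  rewrite aE -mulrBr normrM (gtr0_norm B0) -ler_pdivlMl// [leRHS]mulrC pP//.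
  by rewrite normrM gtr0_norm ?invr_gt0// ler_pdivrMl// mulr1 aB.
have LN g : L g -> L (fun x => - g x).
  move=> /(LZ (-1)); congr L; apply/funext => x; exact: mulN1r.
have Lmin g h : L g -> L h -> L (fun x => Num.min (g x) (h x)).
  move=> Lg Lh; rewrite (_ : (fun _ => _) =
      (fun x => 2^-1 * ((g \+ h) \+ (fun x => - `|(g \+ (fun x => - h x)) x|)) x)).
    apply: (LZ _ _); apply: (LD _ _); first exact: (LD _ _).
    by apply: (LN _); apply: (Lnorm _); apply: (LD _ _) => //; exact: (LN _).
  by apply/funext => x; rewrite minr_absE mulrC.
have Lcst r : L (cst r) by exact: LA (algebra_cst alg r).
have [[x0 Kx0]|K0] := pselect (K !=set0); last first.
  exists (cst 0); first exact: algebra_cst.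
  by move=> x Kx; exfalso; apply: K0; exists x.
have interp x y : K x -> K y -> exists2 h, L h & h x = f x /\ h y = f y.
  move=> Kx Ky; have [->|/eqP xy] := eqVneq x y; first by exists (cst (f y)).
  have [a Aa /eqP axy] := sep x y Kx Ky xy.
  have d0 : a y - a x != 0 by rewrite subr_eq0 eq_sym.
  exists (cst (f x) \+ (fun z => ((f y - f x) / (a y - a x)) * (a \+ cst (- a x)) z)).
    by apply: (LD _ _) => //; apply: (LZ _ _); apply: (LD _ _) => //; exact: (LA _).
  by rewrite /= subrr mulr0 addr0 -mulrA mulVf// mulr1 subrKC.
have fD (r : R) : continuous (f \+ cst r).
  by move=> x; apply: cvgD; [exact: cf|exact: cvg_cst].
(* Functions equal to [f] at [x] and below [f + e] everywhere on [K]. *)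
have upper x : K x -> exists2 g, L g & g x = f x /\ forall y, K y -> g y < f y + e.
  move=> Kx; pose Lx := [set h | L h /\ h x = f x].
  have [|||y Ky|g [Lg gx] gf] := @compact_directed_lt K (f \+ cst e) Lx cK (fD e).
  - by exists (cst (f x)); split.
  - by move=> h [[]].
  - by move=> g h [Lg gx] [Lh hx]; split; [exact: (Lmin _ _)|rewrite gx hx minxx].
  - have [h Lh [hx hy]] := interp x y Kx Ky; exists h => //=.
    by rewrite hy ltrDl.
  - by exists g.
(* The negatives of these functions, so that the maximum becomes a minimum. *)
pose L' := [set h | L (fun x => - h x) /\ forall y, K y -> - h y < f y + e].
have up' x : K x -> exists2 h, L' h & h x = - f x.
  move=> Kx; have [g Lg [gx gf]] := upper x Kx; exists (fun x => - g x); last by rewrite gx.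
  split; last by move=> y Ky; rewrite opprK gf.
  by under eq_fun do rewrite opprK.
have cfN : continuous ((fun x => - f x) \+ cst e).
  by move=> x; apply: cvgD; [apply: cvgN; exact: cf|exact: cvg_cst].
have [|||x Kx|h [Lh hf] hf'] := @compact_directed_lt K ((fun x => - f x) \+ cst e) L' cK cfN.
- by have [h L'h _] := up' _ Kx0; exists h.
- move=> h [[ch _] _]; rewrite (_ : h = fun x => - - h x); last first.
    by apply/funext => x; rewrite opprK.
  by move=> x; apply: cvgN; exact: ch.
- move=> g h [Lg gf] [Lh hf]; split.
    rewrite (_ : (fun _ => _) =
      (fun x => - Num.min (- - g x) (- - h x))); last first.
      by apply/funext => x; rewrite !opprK.
    rewrite (_ : (fun _ => _) = 
      (fun x => - (2^-1 * ((fun x => - - g x) \+ (fun x => - - h x) \+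
       (fun x => - `|((fun x => - - g x) \+ (fun x => - - - h x)) x|)) x))).
      apply: (LN); apply: (LZ _ _); apply: (LD _ _); first by apply: (LD _ _); exact: (LN _).
      by apply: (LN _); apply: (Lnorm _); apply: (LD _ _); apply: (LN _) => //; exact: (LN _).
    by apply/funext => x; rewrite minr_absE mulrC.
  move=> y Ky; case: (leP (g y) (h y)) => _; [exact: gf|exact: hf].
- by have [h L'h hx] := up' _ Kx; exists h => //=; rewrite hx ltrDl.
(* By compactness the strict bound [e] can be improved to [e - m], which
   leaves room for passing from the limit [h] to an element of [A]. *)
have [m m0 hm] : exists2 m, 0 < m & forall x, K x -> `|f x + h x| <= e - m.
  have ck : continuous (fun x => `|f x + h x|).
    move=> x; apply: cvg_norm; apply: cvgD; first exact: cf.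
    rewrite (_ : h = fun x => - - h x); last by apply/funext => y; rewrite opprK.
    by apply: cvgN; case: Lh => + _; apply.
  have [z Kz zmax] := @compact_EVT_max E R (fun x => `|f x + h x|) K
    (ex_intro _ x0 Kx0) cK (continuous_subspaceT ck).
  exists (e - `|f z + h z|).
    rewrite subr_gt0 ltr_norml; have := hf z (set_mem Kz); have := hf' z (set_mem Kz) => /=.
    by move=> ? ?; apply/andP; split; lra.
  by move=> x Kx; rewrite subKr zmax// mem_set.
case: Lh => _ /(_ (m / 2)) [|a Aa ha]; first by rewrite divr_gt0.
exists a => // x Kx; have := ha x Kx; have := hm x Kx.
rewrite ltr_norml !ler_norml => /andP[? ?] /andP[? ?].
by apply/andP; split; lra.
Qed.

End stone_weierstrass.

(** * Stone-Weierstrass theorem for weighted norms *)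

Lemma continuous_combination {R : realType} {E : topologicalType} (r : R) (f g : E -> R) :
  continuous f -> continuous g -> continuous (fun x => r * f x + g x).
Proof.
move=> cf cg x; apply: cvgD; last exact: cg.
by apply: cvgMr; exact: cf.
Qed.

Lemma continuous_clamp {R : realType} (B : R) :
  continuous (fun t => Num.max (- B) (Num.min B t)).
Proof.
move=> t; apply: (@continuous_max _ _ (cst (- B))); first exact: cvg_cst.
by apply: (@continuous_min _ _ (cst B)); [exact: cvg_cst|exact: cvg_id].
Qed.

Lemma poly_approximation {R : realType} (f : R -> R) (a b e : R) :
  continuous f -> 0 < e ->
  exists q : {poly R}, forall x, a <= x <= b -> `|f x - q.[x]| < e.
Proof.
move=> cf e0.
have := @stone_weierstrass R R `[a, b]
  [set g | exists q : {poly R}, g = (fun x => q.[x])] f e (@segment_compact R a b).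
case=> //.
- split=> [r|_ _ [p ->] [q ->]|_ _ [p ->] [q ->]].
  + by exists r%:P; apply/funext => x; rewrite hornerC.
  + by exists (p + q); apply/funext => x; rewrite hornerD.
  + by exists (p * q); apply/funext => x; rewrite hornerM.
- by move=> _ [q ->]; exact: continuous_horner.
- move=> x y _ _ xy; exists (fun x => x) => //.
  by exists 'X; apply/funext => z; rewrite hornerX.
- by move=> _ [q ->] H; exists q => x xab; apply: H; rewrite /= in_itv.
Qed.

Section sin_taylor.
Context {R : realType}.

Lemma series_exp_coeff_le (x : R) n : 0 <= x -> series (exp_coeff x) n <= expR x.
Proof.
move=> x0; rewrite /expR; apply: nondecreasing_cvgn_le; last exact: is_cvg_series_exp_coeff.
apply/nondecreasing_seqP => k; rewrite /series/= big_nat_recr//= lerDl.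
exact: exp_coeff_ge0.
Qed.

(** In the remainder, [|x| ^ k <= 2 ^- n * (2 * |x|) ^ k] for [k >= n]: the error
    decays geometrically at the price of doubling the exponential rate. *)
Lemma sin_taylor (x : R) n :
  `|sin x - \sum_(0 <= k < n) sin_coeff x k| <= 2^-1 ^+ n * expR (2 * `|x|).
Proof.
have bound m : (n <= m)%N -> `|series (sin_coeff x) m - series (sin_coeff x) n| <=
    2^-1 ^+ n * expR (2 * `|x|).
  move=> nm; rewrite sub_series_geq//.
  rewrite (le_trans (ler_norm_sum _ _ _))//.
  rewrite (@le_trans _ _ (\sum_(n <= k < m) 2^-1 ^+ n * exp_coeff (2 * `|x|) k))//.
    rewrite big_nat_cond [leRHS]big_nat_cond.
    apply: ler_sum => k; rewrite andbT => /andP[nk _].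
    rewrite /sin_coeff /exp_coeff /=.
    rewrite !normrM normfV !normr_nat !normrX normrN normr1 expr1n mulr1.
    have E : 2^-1 ^+ n * 2 ^+ k = 2 ^+ (k - n) :> R.
      by rewrite -{1}(subnK nk) exprD mulrCA -exprMn mulVf// expr1n mulr1.
    rewrite exprMn !mulrA ler_wpM2r ?invr_ge0// E.
    rewrite ler_wpM2r// ?exprn_ge0// (@le_trans _ _ 1)//; first by case: odd.
    by rewrite exprn_ege1// ler1n.
  rewrite -mulr_sumr ler_wpM2l ?exprn_ge0 ?invr_ge0//.
  rewrite (le_trans _ (series_exp_coeff_le m _)) ?mulr_ge0//.
  rewrite -sub_series_geq// lerBlDr lerDl /series/= sumr_ge0// => k _.
  by rewrite exp_coeff_ge0// mulr_ge0.
have cv : `|series (sin_coeff x) m - series (sin_coeff x) n| @[m --> \oo] -->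
    `|sin x - series (sin_coeff x) n|.
  apply: cvg_norm; apply: cvgB; last exact: cvg_cst.
  by rewrite unlock; exact: is_cvg_series_sin_coeff.
apply: (cvgr_to_le cv); near=> m; apply: bound.
by near: m; exact: nbhs_infty_ge.
Unshelve. all: by end_near. Qed.

End sin_taylor.

Section weighted_stone_weierstrass.
Context {R : realType} {E : topologicalType}.
Variables (psi : E -> R) (A : set (E -> R)).
Hypotheses (psi1 : forall x, 1 <= psi x) (algA : function_algebra A).
Hypothesis contA : forall a, A a -> continuous a.
Hypothesis growA : forall a, A a -> exists C : R, forall x, `|a x| <= C * psi x.
Implicit Types (f g : E -> R).

Definition approximable f := forall e : R, 0 < e ->
  exists2 a, A a & forall x, `|f x - a x| <= e * psi x.

Let psi0 x : 0 < psi x. Proof. exact: lt_le_trans (psi1 x). Qed.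

Lemma approximableA a : A a -> approximable a.
Proof. by move=> Aa e e0; exists a => // x; rewrite subrr normr0 mulr_ge0// ltW. Qed.

Lemma approximable_closed f :
  (forall e : R, 0 < e -> exists2 g, approximable g & forall x, `|f x - g x| <= e * psi x) ->
  approximable f.
Proof.
move=> H e e0; have e20 : 0 < e / 2 by rewrite divr_gt0.
have [g Vg fg] := H _ e20; have [a Aa ga] := Vg _ e20.
exists a => // x; rewrite -(subrK (g x) (f x)) -addrA (le_trans (ler_normD _ _))//.
by rewrite (splitr e) mulrDl lerD// ?fg ?ga.
Qed.

Lemma approximableD f g : approximable f -> approximable g -> approximable (f \+ g).
Proof.
move=> Vf Vg e e0; have e20 : 0 < e / 2 by rewrite divr_gt0.
have [a Aa fa] := Vf _ e20; have [b Ab gb] := Vg _ e20.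
exists (a \+ b); first exact: algebraD.
move=> x /=; rewrite opprD addrACA (le_trans (ler_normD _ _))//.
by rewrite (splitr e) mulrDl lerD ?fa ?gb.
Qed.

(** The multipliers replace products of trigonometric functions: a product of
    several [sin (k * g)] need not have a Taylor series that converges in the
    weighted norm, but it is still a multiplier. *)
Definition multiplier f := [/\ continuous f, exists B : R, forall x, `|f x| <= B &
  forall a, A a -> approximable (f \* a)].

(** For products, [F * (G * a)] is approximated by [F * b] with [b] in [A] close to
    [G * a] in the weighted norm, since [F] is bounded. *)
Lemma multiplier_algebra : function_algebra multiplier.
Proof.
split=> [r|f g [cf [B fB] Mf] [cg [B' gB'] Mg]|f g [cf [B fB] Mf] [cg [B' gB'] Mg]].
- split; [exact: cst_continuous|by exists `|r| |move=> a Aa].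
  by apply: approximableA; exact: algebraZ.
- split; first by move=> x; apply: cvgD; [exact: cf|exact: cg].
    by exists (B + B') => x; rewrite (le_trans (ler_normD _ _))// lerD.
  move=> a Aa; rewrite (_ : _ \* a = (f \* a) \+ (g \* a)).
    by apply: approximableD; [exact: Mf|exact: Mg].
  by apply/funext => x /=; rewrite mulrDl.
- split; first by move=> x; apply: cvgM; [exact: cf|exact: cg].
    by exists (B * B') => x; rewrite normrM ler_pM.
  move=> a Aa; apply: approximable_closed => e e0.
  have B1 : 0 < `|B| + 1 by rewrite ltr_wpDl.
  have [b Ab gab] := Mg a Aa _ (divr_gt0 e0 B1).
  exists (f \* b); first exact: Mf.
  move=> x /=; rewrite -mulrA -mulrBr normrM.
  rewrite (@le_trans _ _ ((`|B| + 1) * (e / (`|B| + 1) * psi x)))//.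
    rewrite ler_pM// ?gab// (le_trans (fB x))// (le_trans (ler_norm _))//.
    by rewrite lerDl.
  by rewrite mulrA [_ * (e / _)]mulrC divfK// gt_eqF.
Qed.

Lemma multiplier_closed f : continuous f ->
  (forall e : R, 0 < e -> exists2 g, multiplier g & forall x, `|f x - g x| <= e) ->
  multiplier f.
Proof.
move=> cf H; split=> //.
  have [g [_ [B gB] _] fg] := H 1 ltr01; exists (1 + B) => x.
  by rewrite -(subrK (g x) (f x)) (le_trans (ler_normD _ _))// lerD.
move=> a Aa; have [C aC] := growA Aa.
apply: approximable_closed => e e0.
have C1 : 0 < `|C| + 1 by rewrite ltr_wpDl.
have [g [_ _ Mg] fg] := H _ (divr_gt0 e0 C1).
exists (g \* a); first exact: Mg.
move=> x /=; rewrite -mulrBl normrM.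
rewrite (@le_trans _ _ (e / (`|C| + 1) * ((`|C| + 1) * psi x)))//.
  rewrite ler_pM// (le_trans (aC x))// ler_wpM2r// 1?ltW//.
  by rewrite (le_lt_trans (ler_norm _))// ltrDl.
by rewrite mulrA divfK// gt_eqF.
Qed.

(** A multiplier is bounded, and on the interval of its values [c] is a uniform
    limit of polynomials. *)
Lemma multiplier_comp (c : R -> R) g : continuous c -> multiplier g ->
  multiplier (c \o g).
Proof.
move=> cc Mg; have [cg [B gB] _] := Mg; apply: multiplier_closed.
  by move=> x; apply: continuous_comp; [exact: cg|exact: cc].
move=> e e0; have [q qP] := @poly_approximation R c (- B) B e cc e0.
exists (fun x => q.[g x]); first exact: (algebra_horner _ multiplier_algebra).
by move=> x; rewrite ltW// qP// -ler_norml.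
Qed.

(** The factor [2] in the growth condition pays for the exponential in the
    remainder bound [sin_taylor]. *)
Lemma multiplier_sin g (h : R) : A g -> 0 <= h ->
  (forall a, A a -> exists C : R, forall x, `|a x| * expR (2 * h * `|g x|) <= C * psi x) ->
  multiplier (fun x => sin (h * g x)).
Proof.
move=> Ag h0 growh; split.
- move=> x; apply: continuous_comp; last exact: continuous_sin.
  by apply: cvgMr; exact: contA.
- by exists 1 => x; rewrite sin_max.
move=> a Aa e e0; have [C aC] := growh a Aa.
have C1 : 0 < `|C| + 1 by rewrite ltr_wpDl.
have [n hn] : exists n, 2^-1 ^+ n <= e / (`|C| + 1).
  have : 2^-1 ^+ n @[n --> \oo] --> (0 : R) by apply: cvg_expr; rewrite ger0_norm; lra.
  move/cvgrPdist_le => /(_ _ (divr_gt0 e0 C1)) [n _ /(_ n (leqnn n))].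
  by rewrite /= sub0r normrN ger0_norm ?exprn_ge0// => ?; exists n.
pose p := \poly_(k < n) ((odd k)%:R * (-1) ^+ k.-1./2 / k`!%:R : R).
exists ((fun x => p.[h * g x]) \* a).
  by apply: algebraM => //; apply: algebra_horner => //; exact: algebraZ.
move=> x /=; rewrite -mulrBl normrM.
have -> : p.[h * g x] = \sum_(0 <= k < n) sin_coeff (h * g x) k.
  rewrite horner_poly big_mkord; apply: eq_bigr => k _.
  by rewrite sin_coeffE.
rewrite (@le_trans _ _ (2^-1 ^+ n * expR (2 * h * `|g x|) * `|a x|))//.
  rewrite ler_wpM2r//.
  by rewrite (le_trans (sin_taylor _ _))// normrM (ger0_norm h0) mulrA.
rewrite -mulrA (mulrC (expR _)).
rewrite (@le_trans _ _ (e / (`|C| + 1) * ((`|C| + 1) * psi x)))//.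
  rewrite ler_pM ?exprn_ge0 ?mulr_ge0 ?expR_ge0//.
  rewrite (le_trans (aC x))// ler_wpM2r// 1?ltW//.
  by rewrite (le_lt_trans (ler_norm _))// ltrDl.
by rewrite mulrA divfK// gt_eqF.
Qed.

(** Scaling both points into the interval where the sine is injective. *)
Lemma sin_scaled_inj (h s t : R) : 0 < h -> s <> t ->
  exists2 k, 0 < k <= h & sin (k * s) <> sin (k * t).
Proof.
move=> h0 st; have d0 : 0 < 1 + `|s| + `|t| by rewrite -addrA ltr_pwDl// addr_ge0.
pose k := Num.min h (1 + `|s| + `|t|)^-1.
have k0 : 0 < k by rewrite lt_min h0 invr_gt0.
exists k; first by rewrite k0 ge_min lexx.
have small r : `|r| <= 1 + `|s| + `|t| -> k * r \in `[(- (pi / 2)), (pi / 2)].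
  move=> rst; rewrite in_itv/= -ler_norml normrM (gtr0_norm k0).
  rewrite (@le_trans _ _ 1)//; last by rewrite ler_pdivlMr// mul1r pi_ge2.
  by rewrite -(mulVf (lt0r_neq0 d0)) ler_pM ?(ltW k0)// ge_min lexx orbT.
move=> /sin_inj; have := normr_ge0 s; have := normr_ge0 t => t0 s0.
rewrite !small; [|lra|lra] => /(_ isT isT) /(mulfI (lt0r_neq0 k0)).
exact: st.
Qed.

Hypothesis cpt : forall r, compact [set x | psi x <= r].
Hypothesis sepA : forall x y, x <> y -> exists2 g, A g & g x <> g y /\
  exists2 h : R, 0 < h & forall a, A a ->
    exists C : R, forall z, `|a z| * expR (h * `|g z|) <= C * psi z.

(** The level [2 * B / e] is such that off the sublevel set the trivial error
    bound [2 * B] is at most [e * psi]. Truncation at height [B] preserves the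
    approximation on the sublevel set and makes the trivial bound available. *)
Theorem weighted_stone_weierstrass f (B : R) : continuous f ->
  (forall x, `|f x| <= B) -> approximable f.
Proof.
move=> cf fB; apply: approximable_closed => e e0.
pose c (t : R) := Num.max (- B) (Num.min B t).
have cc : continuous c by exact: continuous_clamp.
have [||g Mg fg] := @stone_weierstrass R E [set x | psi x <= 2 * B / e] multiplier f e
  (@cpt _) multiplier_algebra _ _ cf e0.
- by move=> a [].
- move=> x y _ _ xy; have [g Ag [gxy [h h0 gh]]] := sepA xy.
  have [|k /andP[k0 kh] sk] := @sin_scaled_inj (h / 2) _ _ _ gxy; first by rewrite divr_gt0.
  exists (fun x => sin (k * g x)) => //; apply: multiplier_sin => //; first exact: ltW.
  move=> a Aa; have [C aC] := gh a Aa; exists C => z; apply: le_trans (aC z).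
  by rewrite ler_wpM2l// ler_expR ler_wpM2r//; lra.
- exists (c \o g).
    have [_ _ /(_ (cst 1) (algebra_cst algA 1))] := multiplier_comp cc Mg.
    by congr approximable; apply/funext => x /=; rewrite mulr1.
  move=> x /=; have := fB x; rewrite ler_norml => /andP[? ?].
  have [xK|xK] := leP (psi x) (2 * B / e).
    rewrite (@le_trans _ _ e)//; last by rewrite ler_peMr// ltW.
    have := fg x xK; rewrite ltr_norml ler_norml => /andP[? ?].
    by rewrite /c; case: (leP B (g x)) => ?; case: (leP (- B)) => ?; apply/andP; split; lra.
  rewrite (@le_trans _ _ (2 * B))//; last by rewrite [leRHS]mulrC -ler_pdivrMr// ltW.
  rewrite ler_norml.
  by rewrite /c; case: (leP B (g x)) => ?; case: (leP (- B)) => ?; apply/andP; split; lra.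
Qed.

End weighted_stone_weierstrass.

(** * Integration through second-order increments *)

Section increment_calculus.
Context {R : realType}.
Implicit Types (a b c u v : R) (f g h k F G H W : R -> R).

Definition lip a b f := exists2 L : R, 0 <= L &
  forall u v, a <= u -> u <= v -> v <= b -> `|f v - f u| <= L * (v - u).

Definition second_order a b (delta : R -> R -> R) := exists2 C : R, 0 <= C &
  forall u v, a <= u -> u <= v -> v <= b -> `|delta u v| <= C * (v - u) ^+ 2.

(** A derivative-free form of [dF = f dg], suited to [f] and [g] Lipschitz. *)
Definition primitive a b f g F :=
  second_order a b (fun u v => F v - F u - f u * (g v - g u)).

(** [W b - W a] is an upper bound for the total variation of [g] on [[a, b]]. *)
Definition control a b g W :=
  forall u v, a <= u -> u <= v -> v <= b -> `|g v - g u| <= W v - W u.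

Lemma second_orderD a b d1 d2 : second_order a b d1 -> second_order a b d2 ->
  second_order a b (fun u v => d1 u v + d2 u v).
Proof.
move=> [C C0 H] [C' C'0 H']; exists (C + C'); first exact: addr_ge0.
move=> u v au uv vb; rewrite (le_trans (ler_normD _ _))// mulrDl lerD//.
  exact: H.
exact: H'.
Qed.

Lemma second_orderM a b f (B : R) d : (forall u, a <= u <= b -> `|f u| <= B) ->
  second_order a b d -> second_order a b (fun u v => f u * d u v).
Proof.
move=> fB [C C0 H]; exists (`|B| * C); first exact: mulr_ge0.
move=> u v au uv vb; rewrite normrM -mulrA ler_pM ?H//.
by rewrite (le_trans (fB u _)) ?ler_norm// au (le_trans uv).
Qed.

Lemma second_order_ext a b d1 d2 :
  (forall u v, a <= u -> u <= v -> v <= b -> d1 u v = d2 u v) ->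
  second_order a b d1 -> second_order a b d2.
Proof. by move=> E [C C0 H]; exists C => // u v au uv vb; rewrite -E// H. Qed.

Lemma second_order_lipM a b f g : lip a b f -> lip a b g ->
  second_order a b (fun u v => (f v - f u) * (g v - g u)).
Proof.
move=> [L L0 fL] [M M0 gM]; exists (L * M); first exact: mulr_ge0.
by move=> u v au uv vb; rewrite normrM expr2 mulrACA ler_pM ?fL ?gM.
Qed.

Lemma lip_sub a b c e f : a <= c -> e <= b -> lip a b f -> lip c e f.
Proof.
move=> ac eb [L L0 fL]; exists L => // u v cu uv ve.
by rewrite fL// ?(le_trans ac)// (le_trans ve).
Qed.

Lemma lip_bounded a b f : lip a b f ->
  exists2 B : R, 0 <= B & forall u, a <= u <= b -> `|f u| <= B.
Proof.
have [ab|ba] := leP a b; last first.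
  by move=> _; exists 0 => // u /andP[au ub]; have := le_trans au ub; rewrite leNgt ba.
move=> [L L0 fL]; exists (`|f a| + L * (b - a)).
  by rewrite addr_ge0// mulr_ge0// subr_ge0.
move=> u /andP[au ub]; rewrite -(subrKC (f a) (f u)) (le_trans (ler_normD _ _))//.
by rewrite lerD2l (le_trans (fL _ _ _ au ub))// ler_wpM2l// lerB.
Qed.

Lemma lipD a b f g : lip a b f -> lip a b g -> lip a b (fun u => f u + g u).
Proof.
move=> [L L0 fL] [M M0 gM]; exists (L + M); first exact: addr_ge0.
move=> u v au uv vb; rewrite opprD addrACA (le_trans (ler_normD _ _))// mulrDl.
by rewrite lerD ?fL ?gM.
Qed.

Lemma lip_cst a b (r : R) : lip a b (fun=> r).
Proof. by exists 0 => // u v _ _ _; rewrite subrr normr0 mul0r. Qed.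

Lemma lipM a b f g : lip a b f -> lip a b g -> lip a b (fun u => f u * g u).
Proof.
move=> lf lg; have [[B B0 fB] [B' B'0 gB]] := (lip_bounded lf, lip_bounded lg).
case: lf lg => [L L0 fL] [M M0 gM]; exists (B' * L + B * M).
  by rewrite addr_ge0// mulr_ge0.
move=> u v au uv vb.
have -> : f v * g v - f u * g u = g v * (f v - f u) + f u * (g v - g u) by ring.
rewrite (le_trans (ler_normD _ _))// !normrM mulrDl -!mulrA.
by rewrite lerD// ler_pM ?fL ?gM ?fB ?gB// ?au ?vb ?(le_trans uv)// (le_trans au).
Qed.

Lemma lip_continuous f (L : R) : (forall x y, `|f x - f y| <= L * `|x - y|) ->
  continuous f.
Proof.
move=> fL x; apply/cvgrPdist_le => e e0; have L1 : 0 < `|L| + 1 by rewrite ltr_wpDl.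
near=> y; rewrite (le_trans (fL x y))//.
rewrite (@le_trans _ _ ((`|L| + 1) * `|x - y|))//.
  by rewrite ler_wpM2r// (le_trans (ler_norm _))// lerDl.
rewrite -ler_pdivlMl// mulrC; near: y.
by apply: cvgr_dist_le; [exact: cvg_id|rewrite divr_gt0].
Unshelve. all: by end_near. Qed.

(** Over [n] equal steps the second-order errors add up to [O(1 / n)]. *)
Lemma sewing a b H W (C : R) : a <= b ->
  (forall u v, a <= u -> u <= v -> v <= b ->
    `|H v - H u| <= W v - W u + C * (v - u) ^+ 2) ->
  `|H b - H a| <= W b - W a.
Proof.
move=> ab HW; apply/ler_addgt0Pl => e e0.
have C0 : 0 <= `|C| * (b - a) ^+ 2 by rewrite mulr_ge0// sqr_ge0.
pose n := (Num.truncn (`|C| * (b - a) ^+ 2 / e)).+1.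
have nC : `|C| * (b - a) ^+ 2 / e < n%:R by rewrite truncnS_gt.
have n0 : 0 < n%:R :> R by rewrite ltr0n.
pose t (k : nat) := a + (b - a) * (k%:R / n%:R).
have tn : t n = b by rewrite /t divff ?gt_eqF// mulr1 subrKC.
have t0 : t 0 = a by rewrite /t mul0r mulr0 addr0.
have tS (k : nat) : t k.+1 - t k = (b - a) / n%:R.
  by rewrite /t -natr1; field; rewrite gt_eqF.
have td : 0 <= (b - a) / n%:R by rewrite divr_ge0 ?subr_ge0// ltW.
have tle (k : nat) : (k <= n)%N -> t k <= b.
  move=> kn; rewrite /t -lerBrDl -[leRHS]mulr1 ler_wpM2l ?subr_ge0//.
  by rewrite ler_pdivrMr// mul1r ler_nat.
have tge (k : nat) : a <= t k by rewrite /t lerDl mulr_ge0 ?subr_ge0// divr_ge0// ltW.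
rewrite -tn -t0 -(telescope_sumr (H \o t) (leq0n n)).
rewrite -(telescope_sumr (W \o t) (leq0n n)).
rewrite (le_trans (ler_norm_sum _ _ _))//.
apply: (@le_trans _ _ (\sum_(0 <= i < n) (((W \o t) i.+1 - (W \o t) i) +
    `|C| * ((b - a) / n%:R) ^+ 2))).
  rewrite big_nat [leRHS]big_nat; apply: ler_sum => k /andP[_ kn].
  rewrite (le_trans (HW _ _ (tge _) _ (tle _ kn)))//.
    by rewrite -subr_ge0 tS.
  by rewrite tS lerD2l ler_wpM2r ?sqr_ge0// ler_norm.
rewrite big_split /= addrC lerD2r sumr_const_nat subn0 -[leLHS]mulr_natr.
rewrite (_ : `|C| * ((b - a) / n%:R) ^+ 2 * n%:R = `|C| * (b - a) ^+ 2 / n%:R); last by field; rewrite gt_eqF.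
by rewrite ler_pdivrMr// -ler_pdivrMl// mulrC ltW.
Qed.

Lemma second_order_increment_eq a b H : second_order a b (fun u v => H v - H u) ->
  forall u, a <= u <= b -> H u = H a.
Proof.
move=> [C _ HC] u /andP[au ub]; apply/eqP; rewrite -subr_eq0 -normr_le0.
have : `|H u - H a| <= (cst 0 : R -> R) u - (cst 0 : R -> R) a.
  apply: (@sewing a u H (cst 0) C au) => s t as_ st tu.
  by rewrite /= subr0 add0r HC// (le_trans tu).
by rewrite /= subr0.
Qed.

Lemma primitive_control a b f g F W (M : R) : 
  (forall u, a <= u <= b -> `|f u| <= M) -> control a b g W -> primitive a b f g F ->
  forall u v, a <= u -> u <= v -> v <= b -> `|F v - F u| <= M * (W v - W u).
Proof.
move=> fM gW [C _ FC] u v au uv vb; rewrite mulrBr.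
apply: (@sewing u v F (fun w => M * W w) C uv) => s t us st tv.
have as_ : a <= s by exact: le_trans us.
have tb : t <= b by exact: le_trans vb.
rewrite -(subrK (f s * (g t - g s)) (F t - F s)) addrC (le_trans (ler_normD _ _))//.
rewrite lerD ?FC// normrM -mulrBr ler_pM ?gW// fM//.
by rewrite as_ (le_trans st).
Qed.

Lemma control_id a b : control a b id id.
Proof. by move=> u v _ uv _; rewrite ger0_norm// subr_ge0. Qed.

Lemma control_lip a b g : lip a b g -> exists2 L : R, 0 <= L & control a b g (fun u => L * u).
Proof.
by move=> [L L0 gL]; exists L => // u v au uv vb; rewrite -mulrBr gL.
Qed.

Lemma primitive_lip a b f g F : lip a b f -> lip a b g -> primitive a b f g F ->
  lip a b F.
Proof.
move=> /lip_bounded[B B0 fB] /control_lip[L L0 gL] FP.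
exists (B * L); first exact: mulr_ge0.
by move=> u v au uv vb; rewrite (le_trans (primitive_control fB gL FP au uv vb))// -mulrBr mulrA.
Qed.

(** The product rule: the increment of [F * G] is [F dG + G dF + dF dG], and
    [dF dG] is of second order. *)
Lemma primitiveM a b f g h k F G : lip a b f -> lip a b g -> lip a b h -> lip a b k ->
  primitive a b f g F -> primitive a b h k G ->
  second_order a b (fun u v => F v * G v - F u * G u -
    (F u * h u * (k v - k u) + G u * f u * (g v - g u))).
Proof.
move=> lf lg lh lk PF PG.
have [lF lG] := (primitive_lip lf lg PF, primitive_lip lh lk PG).
have [[BF _ FB] [BG _ GB]] := (lip_bounded lF, lip_bounded lG).
have := second_orderD (second_order_lipM lF lG)
  (second_orderD (second_orderM FB PG) (second_orderM GB PF)).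
by apply: second_order_ext => u v _ _ _; ring.
Qed.

Lemma lip_extension a b f : a <= b -> lip a b f ->
  exists2 g, continuous g & forall x, a <= x <= b -> g x = f x.
Proof.
move=> ab [L L0 fL].
pose cl x := Num.max a (Num.min b x).
have clP x : a <= cl x <= b.
  by rewrite /cl le_max lexx ge_max ab ge_min lexx.
have clL x y : x <= y -> 0 <= cl y - cl x <= y - x.
  move=> xy; rewrite /cl; case: (leP b x) => ?; case: (leP b y) => ?;
  do 2?[case: (leP a) => ?]; apply/andP; split; lra.
exists (f \o cl); last by move=> x /andP[ax xb]; rewrite /= /cl min_r// max_r.
apply: (@lip_continuous _ L) => x y.
wlog xy : x y / y <= x.
  by move=> HW; have [/HW//|/ltW/HW] := leP y x; rewrite distrC (distrC y).
have /andP[c0 c1] := clL _ _ xy; have /andP[ay yb] := clP y.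
have /andP[ax xb] := clP x.
rewrite /= (le_trans (fL _ _ _ _ _))//; first by rewrite -subr_ge0.
by rewrite ler_wpM2l// ger0_norm// subr_ge0.
Qed.

(** The case [g = id]: the Lebesgue integral of a continuous extension of [f]
    has derivative [f], and the mean value theorem gives the error bound. The
    integral starts at [a - 1] so that [a] is an interior point. *)
Lemma lip_primitive a b f : lip a b f -> exists F, primitive a b f id F.
Proof.
have [ab|ba] := leP a b; last first.
  move=> _; exists (cst 0), 0 => // u v au uv vb.
  by have := le_trans (le_trans au uv) vb; rewrite leNgt ba.
move=> lf; have [g cg gf] := lip_extension ab lf; case: lf => L L0 fL.
pose F x := (\int[lebesgue_measure]_(t in `[a - 1, x]) (g t))%R.
have intf : lebesgue_measure.-integrable `[a - 1, b + 1] (EFin \o g).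
  by apply: continuous_compact_integrable; [exact: segment_compact|exact: continuous_subspaceT].
have FD x : a <= x <= b -> is_derive x 1 F (f x).
  move=> /andP[ax xb]; have xb1 : x < b + 1 by lra.
  have ax1 : a - 1 < x by lra.
  have [dF dFE] := continuous_FTC1_closed xb1 intf ax1 (cg x).
  by split => //; rewrite -derive1E dFE gf// ax.
exists F, L => // u v au uv vb.
have dG x : u <= x <= v -> is_derive x 1 (F - (f u \*: (id : R -> R))) (f x - f u).
  move=> /andP[ux xv]; have Fx : is_derive x 1 F (f x).
    by apply: FD; rewrite (le_trans au ux) (le_trans xv vb).
  have := is_deriveB Fx (is_deriveZ (f u) (is_derive_id x (1 : R))).
  by rewrite /GRing.scale/= mulr1.
have [||c cuv] := @MVT_segment R (F - (f u \*: (id : R -> R))) (fun x => f x - f u) u v uv.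
- by move=> x; rewrite in_itv/= => /andP[ux xv]; apply: dG; rewrite !ltW.
- apply: derivable_within_continuous => x; rewrite in_itv/= => /dG.
  by move=> [].
move=> E; have {}E : F v - f u * v - (F u - f u * u) = (f c - f u) * (v - u) by exact: E.
rewrite (_ : _ - _ = F v - f u * v - (F u - f u * u)); last by ring.
rewrite E normrM [`|v - u|]ger0_norm ?subr_ge0// expr2 mulrA.
move: cuv; rewrite in_itv/= => /andP[uc cv].
rewrite ler_wpM2r ?subr_ge0// (le_trans (fL _ _ au uc (le_trans cv vb)))//.
by rewrite ler_wpM2l// lerB.
Qed.

(** When [u <= c <= v] the cross term [(f c - f u) * (g v - g c)] appears; it is
    of second order because [f] and [g] are Lipschitz. *)
Lemma glue_primitive a c b f g F1 F2 : a <= c -> c <= b -> lip a b f -> lip a b g ->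
  primitive a c f g F1 -> primitive c b f g F2 -> exists F, primitive a b f g F.
Proof.
move=> ac cb [L L0 fL] [M M0 gM] [C1 C10 P1] [C2 C20 P2].
exists (fun u => if u <= c then F1 u else F1 c + (F2 u - F2 c)).
exists (C1 + C2 + L * M); first by rewrite !addr_ge0// mulr_ge0.
move=> u v au uv vb; have [vc|cv] := leP v c.
  rewrite (le_trans uv vc) (le_trans (P1 _ _ au uv vc))// ler_wpM2r ?sqr_ge0//.
  by rewrite -addrA lerDl addr_ge0// mulr_ge0.
have [uc|cu] := leP u c; last first.
  rewrite (_ : _ - _ = F2 v - F2 u - f u * (g v - g u)); last by ring.
  rewrite (le_trans (P2 _ _ (ltW cu) uv vb))// ler_wpM2r ?sqr_ge0//.
  by rewrite addrAC lerDr addr_ge0// mulr_ge0.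
have H1 := P1 _ _ au uc (lexx c); have H2 := P2 _ _ (lexx c) (ltW cv) vb.
have H3 := fL _ _ au uc cb; have H4 := gM _ _ ac (ltW cv) vb.
rewrite (_ : _ - _ = (F1 c - F1 u - f u * (g c - g u)) +
  (F2 v - F2 c - f c * (g v - g c)) + (f c - f u) * (g v - g c)); last by ring.
rewrite (le_trans (ler_normD _ _))// [leRHS]mulrDl lerD//.
  rewrite (le_trans (ler_normD _ _))// [leRHS]mulrDl lerD//.
    rewrite (le_trans H1)// ler_wpM2l// lerXn2r ?nnegrE ?subr_ge0//.
    by rewrite lerD2r ltW.
  rewrite (le_trans H2)// ler_wpM2l// lerXn2r ?nnegrE ?subr_ge0//; first exact: ltW.
  by rewrite lerB.
rewrite normrM (le_trans (ler_pM _ _ H3 H4))// mulrACA ler_wpM2l ?mulr_ge0// expr2.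
by rewrite ler_pM ?subr_ge0// ?lerD2r ?lerB// ltW.
Qed.

Lemma glue_control a c b g W1 W2 : a <= c -> c <= b ->
  control a c g W1 -> control c b g W2 ->
  exists2 W, control a b g W & W b - W a = (W1 c - W1 a) + (W2 b - W2 c).
Proof.
move=> ac cb g1 g2; exists (fun u => W1 (Num.min u c) + W2 (Num.max u c)); last first.
  by rewrite min_r// max_l// min_l// max_r//; ring.
move=> u v au uv vb; case: (leP v c) => vc.
  rewrite min_l ?(le_trans uv)// max_r ?(le_trans uv)//.
  by rewrite (le_trans (g1 _ _ au uv vc))//; lra.
case: (leP u c) => uc; last first.
  by rewrite (le_trans (g2 _ _ (ltW uc) uv vb))//; lra.
have -> : g v - g u = (g c - g u) + (g v - g c) by ring.
have := g1 _ _ au uc (lexx c); have := g2 _ _ (lexx c) (ltW vc) vb.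
by move=> ? ?; rewrite (le_trans (ler_normD _ _))//; lra.
Qed.

(** Without division, so that the condition is vacuous for [u = v] and visibly
    passes to pointwise limits. *)
Definition affine_on g u v := forall w, u <= w <= v ->
  (v - u) * g w = (v - w) * g u + (w - u) * g v.

(** [B] is any list containing the break points, in no particular order; this
    makes the break points of a difference the concatenation of two lists. *)
Definition piecewise_affine a b (B : seq R) g := forall u v,
  a <= u -> u <= v -> v <= b -> (forall c, c \in B -> ~~ (u < c < v)) ->
  affine_on g u v.

Lemma affine_onE g u v : u <= v -> affine_on g u v ->
  exists2 m, `|m| * (v - u) = `|g v - g u| &
    forall w, u <= w <= v -> g w = g u + m * (w - u).
Proof.
rewrite le_eqVlt => /predU1P[<- _|uv guv].
  exists 0; first by rewrite !subrr normr0 mul0r.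
  by move=> w; rewrite -eq_le => /eqP <-; rewrite subrr mulr0 addr0.
have vu0 : 0 < v - u by rewrite subr_gt0.
exists ((g v - g u) / (v - u)).
  by rewrite normrM normfV (gtr0_norm vu0) divfK ?gt_eqF.
move=> w /guv E; apply: (mulfI (lt0r_neq0 vu0)); rewrite E.
by field; rewrite gt_eqF.
Qed.

(** Cutting at the break points one after the other. Each cut may use the
    remaining break points on both sides, whence the index [n.+1] for two pieces
    of index [n], and constants of the form [2 ^ n] below. *)
Lemma piecewise_affine_ind (P : nat -> R -> R -> Prop) g :
  (forall a b, a <= b -> affine_on g a b -> P 0 a b) ->
  (forall n a b, P n a b -> P n.+1 a b) ->
  (forall n a c b, a <= c -> c <= b -> P n a c -> P n c b -> P n.+1 a b) ->
  forall B a b, a <= b -> piecewise_affine a b B g -> P (size B) a b.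
Proof.
move=> P0 Pw PS; elim=> [|c B IH] a b ab gB; first exact/P0/gB.
have [/andP[ac cb]|cab] := boolP (a < c < b); last first.
  apply: Pw; apply: IH => // u v au uv vb uvB; apply: gB => // e.
  rewrite inE => /predU1P[->|]; last exact: uvB.
  apply: contra cab => /andP[uc cv].
  by rewrite (le_lt_trans au uc) (lt_le_trans cv vb).
apply: (PS _ _ c); rewrite ?(ltW ac) ?(ltW cb)//; apply: IH; rewrite ?(ltW ac) ?(ltW cb)//.
  move=> u v au uv vc uvB; apply: gB => //; first by rewrite (le_trans vc)// ltW.
  move=> e; rewrite inE => /predU1P[->|]; last exact: uvB.
  by rewrite [c < v]ltNge vc andbF.
move=> u v cu uv vb uvB; apply: gB => //; first by rewrite (le_trans _ cu)// ltW.
move=> e; rewrite inE => /predU1P[->|]; last exact: uvB.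
by rewrite ltNge cu.
Qed.

Lemma piecewise_affine_primitive a b B f g : a <= b -> lip a b f -> lip a b g ->
  piecewise_affine a b B g -> exists F, primitive a b f g F.
Proof.
move=> ab lf lg gB.
pose P (n : nat) u v := a <= u -> v <= b -> exists F, primitive u v f g F.
apply: (@piecewise_affine_ind P g _ _ _ B a b) => //.
- move=> u v uv guv au vb; have [m _ gm] := affine_onE uv guv.
  have [F PF] := lip_primitive (lip_sub au vb lf).
  exists (fun w => m * F w).
  have bm w : u <= w <= v -> `|(fun=> m) w : R| <= `|m| by [].
  have := second_orderM bm PF.
  apply: second_order_ext => s t us st tv; have sv := le_trans st tv.
  by rewrite (gm s) ?us// (gm t) ?tv ?(le_trans us)//; ring.
- move=> n u c v uc cv P1 P2 au vb.
  have [F1 PF1] := P1 au (le_trans cv vb).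
  have [F2 PF2] := P2 (le_trans au uc) vb.
  by apply: glue_primitive uc cv _ _ PF1 PF2; exact: lip_sub au vb _.
Qed.

(** The variation of an affine function is the size of its increment, at most
    [2 * M]. *)
Lemma piecewise_affine_control a b B g (M : R) : a <= b ->
  (forall u, a <= u <= b -> `|g u| <= M) -> piecewise_affine a b B g ->
  exists2 W, control a b g W & W b - W a <= 2 ^+ (size B) * (2 * M).
Proof.
move=> ab gM gB; have M0 : 0 <= M by rewrite (le_trans _ (gM a _))// lexx.
pose P (n : nat) u v := a <= u -> v <= b ->
  exists2 W, control u v g W & W v - W u <= 2 ^+ n * (2 * M).
apply: (@piecewise_affine_ind P g _ _ _ B a b) => //.
- move=> u v uv guv au vb; have [m mE gm] := affine_onE uv guv.
  exists (fun w => `|m| * w).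
    move=> s t us st tv; rewrite -mulrBr -[t - s]ger0_norm ?subr_ge0// -normrM.
    have sv := le_trans st tv.
    rewrite (gm s) ?us// (gm t) ?tv ?(le_trans us)//.
    by rewrite le_eqVlt; apply/orP; left; apply/eqP; congr (`|_|); ring.
  rewrite -mulrBr mE expr0 mul1r mulr2n mulrDl mul1r (le_trans (ler_normB _ _))//.
  by rewrite lerD// gM ?au ?vb ?(le_trans uv)// (le_trans au).
- move=> n u v H au vb; have [W gW WM] := H au vb; exists W => //.
  by rewrite (le_trans WM)// ler_wpM2r ?mulr_ge0// exprS ler_peMl ?exprn_ge0// ler1n.
- move=> n u c v uc cv P1 P2 au vb.
  have [W1 gW1 WM1] := P1 au (le_trans cv vb).
  have [W2 gW2 WM2] := P2 (le_trans au uc) vb.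
  have [W gW WE] := glue_control uc cv gW1 gW2; exists W => //; rewrite WE.
  by rewrite exprS -mulrA mulr2n mulrDl mul1r lerD.
Qed.

Lemma piecewise_affineB a b B B' f g :
  piecewise_affine a b B f -> piecewise_affine a b B' g ->
  piecewise_affine a b (B ++ B') (fun u => f u - g u).
Proof.
move=> fB gB u v au uv vb H w uwv.
have Ef : (v - u) * f w = (v - w) * f u + (w - u) * f v.
  by apply: fB uwv => // c cB; apply: H; rewrite mem_cat cB.
have Eg : (v - u) * g w = (v - w) * g u + (w - u) * g v.
  by apply: gB uwv => // c cB; apply: H; rewrite mem_cat cB orbT.
by rewrite mulrBr Ef Eg; ring.
Qed.

End increment_calculus.

(** * Riemann-Stieltjes integrals and the shuffle relation *)

Section riemann_stieltjes_theory.
Context {R : realType}.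
Implicit Types (a b u v : R) (f g F : R -> R).

Section partition_points.
Variables (a b : R) (s : seq R).
Hypothesis abs : itv_partition a b s.
Let t := nth b (a :: s).

Lemma partition_lt k : (k < size s)%N -> t k < t k.+1.
Proof. by case: abs => /(pathP b) H _ ks; exact: H. Qed.

Lemma partition_le (m k : nat) : (m <= k)%N -> (k <= size s)%N -> t m <= t k.
Proof.
elim: k => [|k IH]; first by rewrite leqn0 => /eqP ->.
rewrite leq_eqVlt => /predU1P[-> //|mk] ks.
by rewrite (le_trans (IH _ _))// 1?ltnW// ltW// partition_lt.
Qed.

Lemma partition_last : t (size s) = b.
Proof. by case: abs => _ /eqP; rewrite (last_nth b). Qed.

Lemma partition_itv k : (k <= size s)%N -> a <= t k <= b.
Proof.
move=> ks; rewrite (partition_le (leq0n k) ks)/=.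
by rewrite -[leRHS]partition_last partition_le.
Qed.

Lemma partition_tag (xi : nat -> R) k : (k < size s)%N -> t k <= xi k <= t k.+1 ->
  a <= xi k <= b.
Proof.
move=> ks /andP[x1 x2]; have /andP[H _] := partition_itv (ltnW ks).
by have /andP[_ H'] := partition_itv ks; rewrite (le_trans H x1) (le_trans x2 H').
Qed.

End partition_points.

Lemma fine_partition a b (delta : R) : a <= b -> 0 < delta ->
  exists2 s, itv_partition a b s & forall k, (k < size s)%N ->
    nth b (a :: s) k.+1 - nth b (a :: s) k < delta.
Proof.
rewrite le_eqVlt => /predU1P[<- _|ab d0].
  by exists [::] => //; split.
pose n := (Num.truncn ((b - a) / delta)).+1.
have n0 : 0 < n%:R :> R by rewrite ltr0n.
have nd : (b - a) / n%:R < delta.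
  by rewrite ltr_pdivrMr// -ltr_pdivrMl// mulrC truncnS_gt.
pose t (k : nat) := a + (b - a) * (k%:R / n%:R).
have tS (k : nat) : t k.+1 - t k = (b - a) / n%:R.
  by rewrite /t -natr1; field; rewrite gt_eqF.
have sE k : (k <= n)%N -> nth b (a :: mkseq (fun k => t k.+1) n) k = t k.
  case: k => [|k] kn /=; first by rewrite /t mul0r mulr0 addr0.
  by rewrite nth_mkseq.
exists (mkseq (fun k => t k.+1) n).
  split.
    apply/(pathP b) => k; rewrite size_mkseq => kn.
    rewrite (sE _ (ltnW kn)) nth_mkseq// -subr_gt0 tS divr_gt0// subr_gt0//.
  rewrite (last_nth b) size_mkseq sE// /t divff ?(lt0r_neq0 n0)//.
  by rewrite mulr1 subrKC.
by move=> k; rewrite size_mkseq => kn; rewrite !sE ?tS// ltnW.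
Qed.

Lemma RS_integral_unique f g a b (l1 l2 : R) : a <= b ->
  is_RS_integral f g a b l1 -> is_RS_integral f g a b l2 -> l1 = l2.
Proof.
move=> ab H1 H2; apply/eqP/negPn/negP => l12.
have e0 : 0 < `|l1 - l2| / 2 by rewrite divr_gt0// normr_gt0 subr_eq0.
have [d1 d10 D1] := H1 _ e0; have [d2 d20 D2] := H2 _ e0.
have [|s abs sd] := @fine_partition a b (Num.min d1 d2) ab.
  by rewrite lt_min d10.
pose t := nth b (a :: s).
have tag k : (k < size s)%N -> t k <= t k <= t k.+1.
  by move=> ks; rewrite lexx ltW// partition_lt.
have m1 k : (k < size s)%N -> t k.+1 - t k < d1.
  by move=> /sd; rewrite lt_min => /andP[].
have m2 k : (k < size s)%N -> t k.+1 - t k < d2.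
  by move=> /sd; rewrite lt_min => /andP[].
have := D1 s t abs tag m1; have := D2 s t abs tag m2.
set S := \sum_(_ < _) _ => S2 S1.
have := ler_distD S l1 l2; rewrite (distrC l1 S) => /le_lt_trans.
by move=> /(_ _ (ltrD S1 S2)); rewrite -splitr ltxx.
Qed.

(** On a step, [f (xi k)] differs from the value of [f] at the left end point by
    [O(mesh)], so that the whole error is [O(mesh)] times the length of
    [[a, b]]. *)
Lemma primitive_RS f g F a b : a <= b -> lip a b f -> lip a b g ->
  primitive a b f g F -> is_RS_integral f g a b (F b - F a).
Proof.
move=> ab [L L0 fL] [M M0 gM] [C C0 FC] e e0.
pose K := L * M + C; have K0 : 0 <= K by rewrite addr_ge0// mulr_ge0.
have D0 : 0 < K * (b - a) + 1 by rewrite ltr_wpDl// mulr_ge0// subr_ge0.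
exists (e / (K * (b - a) + 1)); first by rewrite divr_gt0.
move=> s xi abs t tag mesh.
have tE : F b - F a = \sum_(k < size s) (F (t k.+1) - F (t k)).
  rewrite -(big_mkord xpredT (fun k => F (t k.+1) - F (t k))).
  by rewrite (telescope_sumr (F \o t) (leq0n _))/= /t (partition_last abs).
rewrite tE -sumrB (le_lt_trans (ler_norm_sum _ _ _))//.
apply: (@le_lt_trans _ _ (\sum_(k < size s) (e / (K * (b - a) + 1) * K) * (t k.+1 - t k))).
  apply: ler_sum => k _.
  have ks := ltn_ord k; have /andP[x1 x2] := tag _ ks.
  have /andP[at_ tb] := partition_itv abs (ltnW ks).
  have /andP[at' tb'] := partition_itv abs ks.
  have td : 0 <= t k.+1 - t k by rewrite subr_ge0 ltW// partition_lt.
  rewrite (_ : _ - _ = (f (xi k) - f (t k)) * (g (t k.+1) - g (t k)) -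
    (F (t k.+1) - F (t k) - f (t k) * (g (t k.+1) - g (t k)))); last by ring.
  rewrite (le_trans (ler_normB _ _))//.
  apply: (@le_trans _ _ (K * (t k.+1 - t k) ^+ 2)).
    rewrite /K [leRHS]mulrDl lerD//.
      rewrite normrM expr2 mulrACA ler_pM//.
        rewrite (le_trans (fL _ _ at_ x1 (le_trans x2 tb')))// ler_wpM2l//.
        by rewrite lerD2r.
      by rewrite gM// (le_trans x1).
    by rewrite FC// (le_trans x1).
  rewrite expr2 [e / _ * K]mulrC mulrA ler_wpM2r// ler_wpM2l//.
  by rewrite ltW// mesh.
rewrite -mulr_sumr.
have -> : \sum_(k < size s) (t k.+1 - t k) = b - a.
  rewrite -(big_mkord xpredT (fun k => t k.+1 - t k)).
  by rewrite (telescope_sumr t (leq0n _))/= /t (partition_last abs).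
by rewrite -mulrA mulrAC ltr_pdivrMr// ltr_pM2l// ltrDl.
Qed.

Lemma RS_integralE f g F a b : a <= b -> lip a b f -> lip a b g ->
  primitive a b f g F -> RS_integral f g a b = F b - F a.
Proof.
move=> ab lf lg PF; have H := primitive_RS ab lf lg PF.
by apply: (RS_integral_unique ab _ H); exact: (getI H).
Qed.

Lemma eq_RS_integral f f' g g' a b : (forall u, a <= u <= b -> f u = f' u) ->
  (forall u, a <= u <= b -> g u = g' u) -> RS_integral f g a b = RS_integral f' g' a b.
Proof.
move=> ff gg; rewrite /RS_integral; congr (get _); apply/funext => l.
suff E s (xi : nat -> R) : itv_partition a b s ->
    (forall k, (k < size s)%N -> nth b (a :: s) k <= xi k <= nth b (a :: s) k.+1) ->
    \sum_(k < size s) f (xi k) * (g (nth b (a :: s) k.+1) - g (nth b (a :: s) k)) =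
    \sum_(k < size s) f' (xi k) * (g' (nth b (a :: s) k.+1) - g' (nth b (a :: s) k)).
  apply/propext; split=> H e e0; have [d d0 D] := H e e0; exists d => // s xi abs t tag mesh.
    by rewrite -E// D.
  by rewrite E// D.
move=> abs tag; apply: eq_bigr => k _; have ks := ltn_ord k.
by rewrite ff ?(partition_tag abs ks (tag _ ks))// !gg ?partition_itv// ltnW.
Qed.

End riemann_stieltjes_theory.

Section signature_of_path.
Context {R : realType} {n : nat}.
Variable T : R.
Hypothesis T0 : 0 <= T.
Implicit Types (Y : R -> 'rV[R]_n) (i j : 'I_n) (J K : seq 'I_n).

Definition coord Y i (u : R) : R := Y u 0 i.

Definition regular Y := forall i, lip 0 T (coord Y i) /\
  exists B, piecewise_affine 0 T B (coord Y i).

Lemma regular_primitive Y i f : regular Y -> lip 0 T f ->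
  exists F, primitive 0 T f (coord Y i) F.
Proof.
by move=> /(_ i)[lY [B YB]] lf; exact: piecewise_affine_primitive T0 lf lY YB.
Qed.

Lemma iterated_integral_cons Y i J : regular Y ->
  lip 0 T (iterated_integral Y J) ->
  primitive 0 T (iterated_integral Y J) (coord Y i) (iterated_integral Y (i :: J)).
Proof.
move=> rY lJ; have [F PF] := regular_primitive i rY lJ; have [lY _] := rY i.
case: (PF) => C C0 FC; exists C => // u v u0 uv vT.
have E w : 0 <= w -> w <= T -> iterated_integral Y (i :: J) w = F w - F 0.
  move=> w0 wT; apply: RS_integralE => //; try exact: lip_sub lJ; try exact: lip_sub lY.
  by exists C => // s t s0 st tw; apply: FC => //; exact: le_trans wT.
rewrite !E ?(le_trans uv)// ?(le_trans u0)//.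
rewrite (_ : _ - _ = F v - F u - iterated_integral Y J u * (coord Y i v - coord Y i u)); last by ring.
exact: FC.
Qed.

Lemma iterated_integral_lip Y J : regular Y -> lip 0 T (iterated_integral Y J).
Proof.
move=> rY; elim: J => [|i J IH]; first exact: lip_cst.
have [lY _] := rY i; exact: primitive_lip IH lY (iterated_integral_cons i rY IH).
Qed.

Lemma iterated_integral_primitive Y i J : regular Y ->
  primitive 0 T (iterated_integral Y J) (coord Y i) (iterated_integral Y (i :: J)).
Proof. by move=> rY; apply: iterated_integral_cons => //; exact: iterated_integral_lip. Qed.

Lemma iterated_integral_cons0 Y i J : iterated_integral Y (i :: J) 0 = 0.
Proof.
rewrite /= /RS_integral; apply: (@RS_integral_unique _ (iterated_integral Y J) (coord Y i) 0 0) => //.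
  have : is_RS_integral (iterated_integral Y J) (coord Y i) 0 0 0.
    move=> e e0; exists 1 => // s xi /itv_partitionxx -> /= _ _.
    by rewrite big_ord0 subrr normr0.
  exact: getI.
move=> e e0; exists 1 => // s xi /itv_partitionxx -> /= _ _.
by rewrite big_ord0 subrr normr0.
Qed.

Lemma eq_iterated_integral Y Z J u : (forall w, 0 <= w <= u -> Y w = Z w) ->
  iterated_integral Y J u = iterated_integral Z J u.
Proof.
elim: J u => //= i J IH u YZ; apply: eq_RS_integral => w w0u; last by rewrite YZ.
apply: IH => v /andP[v0 vw]; apply: YZ; rewrite v0 (le_trans vw)//.
by case/andP: w0u.
Qed.

(** [c] lists coefficients and words; as in [iterated_integral], the head of a
    word is the letter integrated last. *)
Definition word_comb Y (c : seq (R * seq 'I_n)) (u : R) : R :=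
  \sum_(w <- c) w.1 * iterated_integral Y w.2 u.

Definition append_letter i (c : seq (R * seq 'I_n)) := [seq (w.1, i :: w.2) | w <- c].

Lemma word_comb_cat Y c1 c2 u :
  word_comb Y (c1 ++ c2) u = word_comb Y c1 u + word_comb Y c2 u.
Proof. exact: big_cat. Qed.

Lemma word_combZ Y (r : R) c u :
  word_comb Y [seq (r * w.1, w.2) | w <- c] u = r * word_comb Y c u.
Proof.
by rewrite /word_comb big_map mulr_sumr; apply: eq_bigr => w _; rewrite /= mulrA.
Qed.

Lemma append_letter_primitive Y i c : regular Y ->
  primitive 0 T (word_comb Y c) (coord Y i) (word_comb Y (append_letter i c)).
Proof.
move=> rY; elim: c => [|w c IH].
  exists 0 => // u v _ _ _.
  by rewrite /word_comb !big_nil subrr mul0r subrr normr0 mul0r.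
have bw (u : R) : 0 <= u <= T -> `|(fun=> w.1) u : R| <= `|w.1| by [].
have := second_orderD (second_orderM bw (iterated_integral_primitive i w.2 rY)) IH.
apply: second_order_ext => u v _ _ _; rewrite /word_comb /= !big_cons /=.
by ring.
Qed.

Lemma append_letter0 Y i c : word_comb Y (append_letter i c) 0 = 0.
Proof.
rewrite /word_comb big_map big1// => w _.
by rewrite iterated_integral_cons0 mulr0.
Qed.

(** By the product rule the product of the integrals of [i :: J] and [j :: K]
    integrates the product for [J] and [j :: K] against the letter [i], plus the
    product for [i :: J] and [K] against [j]. The combination [c] depends on the
    words only. *)
Lemma shuffle_word J K : exists c, forall Y, regular Y -> forall u, 0 <= u <= T ->
  iterated_integral Y J u * iterated_integral Y K u = word_comb Y c u.
Proof.
have [m] := ubnP (size J + size K)%N; elim: m J K => // m IH J K.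
case: J => [|i J] sm.
  exists [:: (1, K)] => Y rY u _.
  by rewrite /word_comb big_seq1 !mul1r.
case: K sm => [|j K] sm.
  exists [:: (1, i :: J)] => Y rY u _.
  by rewrite /word_comb big_seq1 mulr1 mul1r.
have [|c1 H1] := IH J (j :: K); first exact: sm.
have [|c2 H2] := IH (i :: J) K; first by move: sm; rewrite /= addnS.
exists (append_letter i c1 ++ append_letter j c2) => Y rY u u0T.
set D := fun w => iterated_integral Y (i :: J) w * iterated_integral Y (j :: K) w -
  word_comb Y (append_letter i c1 ++ append_letter j c2) w.
suff : D u = D 0.
  rewrite /D !iterated_integral_cons0 mul0r !word_comb_cat !append_letter0 addr0 subrr.
  by move/subr0_eq.
apply: second_order_increment_eq u0T.
have [[li _] [lj _]] := (rY i, rY j).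
have PM := primitiveM (iterated_integral_lip J rY) li (iterated_integral_lip K rY) lj
  (iterated_integral_primitive i J rY) (iterated_integral_primitive j K rY).
have b1 (w : R) : 0 <= w <= T -> `|(fun=> -1) w : R| <= 1 by rewrite normrN1.
have P1 := second_orderM b1 (append_letter_primitive i c1 rY).
have P2 := second_orderM b1 (append_letter_primitive j c2 rY).
have := second_orderD PM (second_orderD P1 P2).
apply: second_order_ext => s t s0 st tT.
rewrite /D !word_comb_cat -(H1 Y rY s) -?(H2 Y rY s) ?s0 ?(le_trans st)//.
by ring.
Qed.

Lemma shuffle c1 c2 : exists c, forall Y, regular Y -> forall u, 0 <= u <= T ->
  word_comb Y c1 u * word_comb Y c2 u = word_comb Y c u.
Proof.
elim: c1 => [|[r J] c1 [c H]].
  by exists [::] => Y _ u _; rewrite /word_comb !big_nil mul0r.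
have [c' H'] : exists c', forall Y, regular Y -> forall u, 0 <= u <= T ->
    iterated_integral Y J u * word_comb Y c2 u = word_comb Y c' u.
  elim: c2 {c H} => [|[r' K] c2 [c H]].
    by exists [::] => Y _ u _; rewrite /word_comb !big_nil mulr0.
  have [c' H'] := shuffle_word J K.
  exists ([seq (r' * w.1, w.2) | w <- c'] ++ c) => Y rY u u0T.
  rewrite word_comb_cat word_combZ -H// -H'// {1}/word_comb big_cons /= -/(word_comb Y c2 u).
  by ring.
exists ([seq (r * w.1, w.2) | w <- c'] ++ c) => Y rY u u0T.
rewrite word_comb_cat word_combZ -H// -H'// {1}/word_comb big_cons /= -/(word_comb Y c1 u).
by ring.
Qed.

End signature_of_path.

(** * Growth and continuity of the signature *)

Section signature_estimates.
Context {R : realType} {n : nat}.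
Variable T : R.
Hypothesis T0 : 0 <= T.
Implicit Types (Y Z : R -> 'rV[R]_n) (i : 'I_n) (J : seq 'I_n).

Definition total_control_le (V : R) (g : R -> R) :=
  exists2 W, control 0 T g W & W T - W 0 <= V.

Lemma control_increment (V : R) g W u : control 0 T g W -> W T - W 0 <= V ->
  0 <= u <= T -> 0 <= W u - W 0 <= V.
Proof.
move=> gW WV /andP[u0 uT]; have := gW _ _ (lexx 0) u0 uT; have := gW _ _ u0 uT (lexx T).
by move=> /(le_trans (normr_ge0 _)) ? /(le_trans (normr_ge0 _)) ?; apply/andP; split; lra.
Qed.

Lemma iterated_integral_bound Y J (V : R) : regular T Y ->
  (forall i, total_control_le V (coord Y i)) ->
  forall u, 0 <= u <= T -> `|iterated_integral Y J u| <= V ^+ size J.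
Proof.
move=> rY YV; elim: J => [|i J IH] u u0T; first by rewrite /= normr1.
have [W YW WV] := YV i; have /andP[u0 uT] := u0T.
have := primitive_control IH YW (iterated_integral_primitive T0 i J rY) (lexx 0) u0 uT.
rewrite iterated_integral_cons0 subr0 => /le_trans; apply.
have /andP[W0 WuV] := control_increment YW WV u0T.
rewrite exprSr ler_wpM2l// exprn_ge0//.
exact: le_trans WuV.
Qed.

(** The two sources of error in [S_J dY - S'_J dZ]: the difference of the
    integrands against [dY], and the integrand [S'_J] against [d(Y - Z)]. *)
Lemma iterated_integral_diff Y Z i J (V M eta delta : R) : regular T Y -> regular T Z ->
  total_control_le V (coord Y i) ->
  total_control_le delta (fun u => coord Y i u - coord Z i u) ->
  (forall u, 0 <= u <= T -> `|iterated_integral Z J u| <= M) ->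
  (forall u, 0 <= u <= T ->
    `|iterated_integral Y J u - iterated_integral Z J u| <= eta) ->
  forall u, 0 <= u <= T ->
    `|iterated_integral Y (i :: J) u - iterated_integral Z (i :: J) u| <=
    eta * V + M * delta.
Proof.
move=> rY rZ [W1 YW1 WV1] [W2 DW2 WV2] ZM YZ u u0T; have /andP[u0 uT] := u0T.
have /andP[I1 I2] := control_increment YW1 WV1 u0T.
have /andP[I3 I4] := control_increment DW2 WV2 u0T.
have M0 : 0 <= M by exact: le_trans (ZM u u0T).
have e0 : 0 <= eta by exact: le_trans (YZ u u0T).
have b1 (w : R) : 0 <= w <= T -> `|(fun=> -1) w : R| <= 1 by rewrite normrN1.
have [C C0 CP] := second_orderD (iterated_integral_primitive T0 i J rY)
  (second_orderM b1 (iterated_integral_primitive T0 i J rZ)).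
pose D w := iterated_integral Y (i :: J) w - iterated_integral Z (i :: J) w.
have : `|D u - D 0| <= (eta * W1 u + M * W2 u) - (eta * W1 0 + M * W2 0).
  apply: (@sewing _ 0 u D (fun w => eta * W1 w + M * W2 w) C u0) => s t s0 st tu.
  have tT := le_trans tu uT; have s0T : 0 <= s <= T by rewrite s0 (le_trans st).
  rewrite (_ : D t - D s = (iterated_integral Y J s - iterated_integral Z J s) *
     (coord Y i t - coord Y i s) + iterated_integral Z J s *
     ((coord Y i t - coord Z i t) - (coord Y i s - coord Z i s)) +
     (iterated_integral Y (i :: J) t - iterated_integral Y (i :: J) s -
       iterated_integral Y J s * (coord Y i t - coord Y i s) +
     -1 * (iterated_integral Z (i :: J) t - iterated_integral Z (i :: J) s -
       iterated_integral Z J s * (coord Z i t - coord Z i s)))); last first.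
    by rewrite /D; ring.
  rewrite (le_trans (ler_normD _ _))// lerD ?CP//.
  rewrite (le_trans (ler_normD _ _))// !normrM.
  rewrite [leRHS](_ : _ = eta * (W1 t - W1 s) + M * (W2 t - W2 s)); last by ring.
  by rewrite lerD// ler_pM// ?YZ ?ZM ?YW1//; exact: DW2.
rewrite {2}/D !iterated_integral_cons0 !subr0 => /le_trans; apply.
rewrite (_ : _ - _ = eta * (W1 u - W1 0) + M * (W2 u - W2 0)); last by ring.
by rewrite lerD// ler_wpM2l.
Qed.

End signature_estimates.

Section stopped_path_signature.
Context {R : realType} {d : nat} {T : R} {p : time_partition T}
  {x0 : 'rV[R]_d} {a : {i01 R}}.
Hypothesis T0 : 0 <= T.
Implicit Types (x y : Lambda p x0 a) (i : 'I_(1 + d)).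

Lemma pl_interp_tail (X : R -> 'rV[R]_d) (c h b : R) s w : itv_partition h b s ->
  c < h -> h <= w -> pl_interp X c (h :: s) w = pl_interp X h s w.
Proof.
move=> hbs ch hw /=; case: leP => // wh.
have -> : w = h by apply/le_anti; rewrite wh hw.
by rewrite (pl_interp_left X hbs) divff ?subr_eq0 ?gt_eqF// scale1r subrKC.
Qed.

Lemma pl_interp_piecewise_affine (X : R -> 'rV[R]_d) (c b : R) s (i : 'I_d) :
  itv_partition c b s ->
  piecewise_affine c b s (fun u => pl_interp X c s u 0 i).
Proof.
elim: s c => [|h s IH] c cbs u v cu uv vb H w /andP[uw wv].
  by rewrite /=; ring.
have hbs := itv_partition_cons cbs.
have ch : c < h by case: cbs => /= /andP[].
have [vh|hv] := leP v h.
  rewrite /= vh (le_trans uv vh) (le_trans wv vh) !mxE.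
  by field; rewrite subr_eq0 gt_eqF.
have hu : h <= u.
  by rewrite leNgt; apply/negP => uh; have := H h; rewrite mem_head uh hv => /(_ isT).
rewrite !(pl_interp_tail X hbs ch) ?(le_trans hu)//.
apply: (IH h hbs u v hu uv vb) => [e es|]; last by rewrite uw.
by apply: H; rewrite inE es orbT.
Qed.

Lemma piecewise_affine_stop (B : seq R) (t : R) (g : R -> R) :
  piecewise_affine 0 T B g -> piecewise_affine 0 T (t :: B) (fun u => g (Num.min u t)).
Proof.
move=> gB u v u0 uv vT H w /andP[uw wv].
have := H t; rewrite mem_head => /(_ isT); rewrite negb_and -!leNgt => /orP[tu|vt].
  by rewrite !min_r ?(le_trans tu)//; ring.
rewrite !min_l ?(le_trans wv)// ?(le_trans uv)//.
apply: (gB u v u0 uv vT); last by rewrite uw.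
by move=> c cB; apply: H; rewrite inE cB orbT.
Qed.

Lemma coord_stopped_time x (k : 'I_1) u : coord (stopped x) (lshift d k) u = u.
Proof. by rewrite /coord /stopped row_mxEl ord1 mxE eqxx mulr1n. Qed.

Lemma stopped_piecewise_affine x i :
  piecewise_affine 0 T (horizon x :: p) (coord (stopped x) i).
Proof.
have [X [/andP[t0 tT] X0 xE]] := LambdaP x.
case: (split_ordP i) => k ->.
  by move=> u v u0 uv vT H w _; rewrite !coord_stopped_time; ring.
have H := @piecewise_affine_stop p (horizon x) _ (pl_interp_piecewise_affine X k (pointsP p)).
move=> u v u0 uv vT uvB w /andP[uw wv]; have w0 := le_trans u0 uw.
have E z : 0 <= z -> coord (stopped x) (rshift 1 k) z =
    pl_interp X 0 p (Num.min z (horizon x)) 0 k.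
  by move=> z0; rewrite /coord (stoppedE t0 xE z0) row_mxEr.
by rewrite !E ?(le_trans u0)//; apply: H => //; rewrite uw.
Qed.

Lemma normr_coord (m : nat) (v : 'rV[R]_m) (i : 'I_m) : `|v 0 i| <= enorm v.
Proof.
rewrite -sqrtr_sqr /enorm ler_sqrt ?sumr_ge0//; last by move=> j _; exact: sqr_ge0.
by rewrite (bigD1 i)//= lerDl sumr_ge0// => j _; exact: sqr_ge0.
Qed.

Lemma entryB (m : nat) (v w : 'rV[R]_m) (i : 'I_m) : (v - w) 0 i = v 0 i - w 0 i.
Proof. by rewrite !mxE. Qed.

Lemma stopped_regular x : regular T (stopped x).
Proof.
move=> i; split; last by exists (horizon x :: p); exact: stopped_piecewise_affine.
have [L L0 HL] := stopped_lip x; exists L => // u v u0 uv vT.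
apply: le_trans (HL _ _ u0 uv vT); have := normr_coord (incr (stopped x) u v) i.
by rewrite /incr entryB.
Qed.

Lemma horizon_itv x : 0 <= horizon x <= T.
Proof. by have [X []] := LambdaP x. Qed.

Lemma path_of_stopped x u : 0 <= u <= horizon x -> path_of x u = stopped x u.
Proof.
move=> /andP[u0 ut]; have [X [/andP[t0 tT] X0 xE]] := LambdaP x.
by rewrite (path_ofE xE) ?u0// (stoppedE t0 xE u0) /time_extend/= min_l.
Qed.

Lemma sig_coordE I x :
  sig_coord I x = iterated_integral (stopped x) (rev I) (horizon x).
Proof. by apply: eq_iterated_integral => w; exact: path_of_stopped. Qed.

Lemma powR_le1D (u b : R) : 0 <= u <= T -> 0 <= b <= 1 -> u `^ b <= 1 + T.
Proof.
move=> /andP[u0 uT] /andP[b0 b1].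
rewrite (@le_trans _ _ ((1 + T) `^ b))//.
  by apply: ge0_ler_powR; rewrite ?nnegrE ?addr_ge0//; lra.
by rewrite -[leRHS]powRr1 ?addr_ge0// ler_powR ?lerDl.
Qed.

Lemma dLambda_ge0 x y : 0 <= dLambda x y.
Proof. by rewrite /dLambda addr_ge0// hoelder_dist_ge0. Qed.

(** Both paths start at [x0], so their difference at [u] is an increment over
    [[0, u]]. *)
Lemma stopped_dist x y i u : 0 <= u <= T ->
  `|coord (stopped x) i u - coord (stopped y) i u| <= (1 + T) * dLambda x y.
Proof.
move=> /andP[]; rewrite le_eqVlt => /predU1P[<- _|u0 uT].
  by rewrite /coord !stopped0 subrr normr0 mulr_ge0 ?dLambda_ge0 ?addr_ge0.
have up : 0 < `|u - 0| `^ a%:num by rewrite powR_gt0// normr_gt0 subr0 gt_eqF.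
have /(ub_le_sup (hoelder_dist_ubound x y)) :
    [set enorm (incr (stopped x) st.1 st.2 - incr (stopped y) st.1 st.2)
         / (`|st.2 - st.1| `^ a%:num) | st in simplex T]
    (enorm (incr (stopped x) 0 u - incr (stopped y) 0 u) / (`|u - 0| `^ a%:num)).
  by exists (0, u) => //=; apply/and3P.
rewrite ler_pdivrMr// => H.
have := normr_coord (incr (stopped x) 0 u - incr (stopped y) 0 u) i.
move=> /le_trans /(_ H); rewrite /incr !stopped0 opprB addrA subrK entryB => /le_trans; apply.
rewrite mulrC ler_pM ?powR_ge0//; first exact: hoelder_dist_ge0.
  apply: powR_le1D; first by rewrite subr0 gtr0_norm// uT ltW.
  by apply/andP; split.
by rewrite /dLambda lerDr.
Qed.

Lemma stopped_diff_control x y i : total_control_le T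
  (2 ^+ (size p).+1.*2 * (2 * ((1 + T) * dLambda x y)))
  (fun u => coord (stopped x) i u - coord (stopped y) i u).
Proof.
have -> : (size p).+1.*2 = size ((horizon x :: p) ++ (horizon y :: p)).
  by rewrite size_cat /= addnn.
apply: piecewise_affine_control => //; first by move=> u; exact: stopped_dist.
by apply: piecewise_affineB; exact: stopped_piecewise_affine.
Qed.

Lemma stopped_control x i (M : R) :
  (forall u, 0 <= u <= T -> `|coord (stopped x) i u - coord (stopped x) i 0| <= M) ->
  total_control_le T (2 ^+ (size p).+1 * (2 * M)) (coord (stopped x) i).
Proof.
move=> HM; have PA : piecewise_affine 0 T ((horizon x :: p) ++ [::])
    (fun u => coord (stopped x) i u - coord (stopped x) i 0).
  apply: piecewise_affineB; first exact: stopped_piecewise_affine.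
  by move=> u v _ _ _ _ w _; ring.
have [W gW WM] := piecewise_affine_control T0 HM PA.
exists W; last by move: WM; rewrite cats0.
by move=> u v u0 uv vT; have := gW u v u0 uv vT; rewrite opprB addrA subrK.
Qed.

(** The constant depends on [x] only: the iterated integrals of a nearby [y] are
    bounded through those of [x]. *)
Lemma iterated_integral_stopped_lip x J : exists2 C : R, 0 <= C &
  forall y, dLambda x y <= 1 -> forall u, 0 <= u <= T ->
  `|iterated_integral (stopped x) J u - iterated_integral (stopped y) J u| <=
  C * dLambda x y.
Proof.
elim: J => [|i J [C C0 HC]].
  by exists 0 => // y _ u _; rewrite subrr normr0 mul0r.
have rx := stopped_regular x.
have [W Wx] : exists V, total_control_le T V (coord (stopped x) i).
  have [lx _] := rx i; have [B _ Bx] := lip_bounded lx.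
  exists (2 ^+ (size p).+1 * (2 * (B + B))); apply: stopped_control => u u0T.
  by rewrite (le_trans (ler_normB _ _))// lerD// Bx// lexx.
have [B B0 Bx] := lip_bounded (iterated_integral_lip T0 J rx).
pose K := 2 ^+ (size p).+1.*2 * (2 * (1 + T)).
have K0 : 0 <= K by rewrite mulr_ge0 ?exprn_ge0 ?mulr_ge0 ?addr_ge0.
exists (C * `|W| + (B + C) * K); first by apply: addr_ge0; apply: mulr_ge0 => //; exact: addr_ge0.
move=> y xy u u0T; have d0 := dLambda_ge0 x y.
have yB w : 0 <= w <= T -> `|iterated_integral (stopped y) J w| <= B + C.
  move=> w0T; rewrite -(subKr (iterated_integral (stopped x) J w) (iterated_integral _ _ _)).
  rewrite (le_trans (ler_normB _ _))// lerD ?Bx// (le_trans (HC y xy w w0T))//.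
  by rewrite ler_piMr.
have := iterated_integral_diff T0 rx (stopped_regular y) Wx (stopped_diff_control x y i)
  yB (HC y xy) u0T.
move=> /le_trans; apply; rewrite [leRHS]mulrDl lerD//.
  by rewrite mulrAC ler_wpM2r// ler_wpM2l// ler_norm.
by rewrite /K !mulrA.
Qed.

Lemma dLambda_continuous (f : Lambda p x0 a -> R) :
  (forall x e, 0 < e -> exists2 r, 0 < r & forall y, dLambda x y < r -> `|f x - f y| <= e) ->
  continuous f.
Proof.
move=> H x; apply/(@cvgrPdist_le _ _ _ (nbhs x) _ f (f x)) => e e0.
by apply/Lambda_nbhsP; have [r r0 rP] := H x e e0; exists r.
Qed.

Definition sig_comb (c : seq (R * seq 'I_(1 + d))) x : R :=
  word_comb (stopped x) c (horizon x).

(** Stopped paths are compared on all of [[0, T]], so that a change of horizon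
    only moves the time at which a Lipschitz function is evaluated. *)
Lemma sig_comb_continuous c : continuous (sig_comb c).
Proof.
have H J : continuous (fun x => iterated_integral (stopped x) J (horizon x)).
  apply: dLambda_continuous => x e e0.
  have [C C0 HC] := iterated_integral_stopped_lip x J.
  have [L L0 HL] := iterated_integral_lip T0 J (stopped_regular x).
  have D0 : 0 < C + L + 1 by rewrite ltr_wpDl// addr_ge0.
  exists (Num.min 1 (e / (C + L + 1))).
    by rewrite lt_min ltr01 divr_gt0.
  move=> y; rewrite lt_min => /andP[xy1 xye] /=.
  rewrite (le_trans (ler_distD (iterated_integral (stopped x) J (horizon y)) _ _))//.
  apply: (@le_trans _ _ ((L + C) * dLambda x y)).
    rewrite mulrDl lerD//; last by apply: HC; rewrite ?horizon_itv// ltW.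
    have [tx ty] := (horizon_itv x, horizon_itv y).
    have thd : `|horizon x - horizon y| <= dLambda x y.
      by rewrite /dLambda lerDl hoelder_dist_ge0.
    apply: (@le_trans _ _ (L * `|horizon x - horizon y|)); last by rewrite ler_wpM2l.
    case/andP: tx => tx0 txT; case/andP: ty => ty0 tyT.
    have [xy|/ltW yx] := leP (horizon x) (horizon y).
      by rewrite distrC (distrC (horizon x)) [`|horizon _ - _|]ger0_norm ?subr_ge0// HL.
    by rewrite [`|horizon _ - _|]ger0_norm ?subr_ge0// HL.
  apply: (@le_trans _ _ ((C + L + 1) * dLambda x y)).
    by rewrite ler_wpM2r ?dLambda_ge0// (addrC L) lerDl.
  by rewrite mulrC -ler_pdivlMr// ltW.
elim: c => [|w c IH].
  rewrite (_ : sig_comb _ = cst 0); first exact: cst_continuous.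
  by apply/funext => x; rewrite /sig_comb /word_comb big_nil.
rewrite (_ : sig_comb _ = fun x => w.1 * iterated_integral (stopped x) w.2 (horizon x) + sig_comb c x).
  exact: continuous_combination.
by apply/funext => x; rewrite /sig_comb /word_comb big_cons.
Qed.

End stopped_path_signature.

(** * Separation of stopped paths by linear functionals *)

Section moments.
Context {R : realType}.
Implicit Types (D F G f g : R -> R) (t u v : R).

(** The bound [|f - B / 2| <= B / 2] for [0 <= f <= B] turns the two-sided
    estimate [primitive_control] into a one-sided one. *)
Lemma primitive_le (t : R) f F : lip 0 t f -> (forall u, 0 <= u <= t -> 0 <= f u) ->
  primitive 0 t f id F -> forall u v, 0 <= u -> u <= v -> v <= t -> F u <= F v.
Proof.
move=> lf f0 PF u v u0 uv vt; have [B B0 fB] := lip_bounded lf.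
have PF' : primitive 0 t (fun w => f w - B / 2) id (fun w => F w - B / 2 * w).
  by apply: second_order_ext PF => s r _ _ _; rewrite /=; ring.
have fB' w : 0 <= w <= t -> `|f w - B / 2| <= B / 2.
  move=> wt; have := f0 w wt; have := fB w wt.
  by rewrite !ler_norml => /andP[? ?] ?; apply/andP; split; lra.
have := primitive_control fB' (@control_id R 0 t) PF' u0 uv vt.
by rewrite ler_norml => /andP[+ _]; rewrite /=; lra.
Qed.

(** Approximating [D] by polynomials shows that the integral of [D ^ 2] vanishes;
    a primitive of [D ^ 2] is monotone, hence constant, hence [D u ^ 2] is
    [O(v - u)] for [v > u]. The end point [t] is excluded since primitives are
    expanded at left end points. *)
Lemma moments_eq0 (t : R) D : lip 0 t D ->
  (forall q : {poly R}, exists2 F, primitive 0 t (fun w => q.[w] * D w) id F & F t = F 0) ->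
  forall u, 0 <= u < t -> D u = 0.
Proof.
move=> lD Dq u /andP[u0 ut]; have t0 : 0 <= t by rewrite ltW// (le_lt_trans u0).
have [B B0 DB] := lip_bounded lD.
have lDD := lipM lD lD.
have [G PG] := lip_primitive lDD.
have [g cg gD] := lip_extension t0 lD.
have Gt : G t = G 0.
  apply/eqP; rewrite -subr_eq0 -normr_le0; apply/ler_addgt0Pl => e e0; rewrite addr0.
  have BT : 0 < B * t + 1 by rewrite ltr_wpDl// mulr_ge0.
  have [q qP] := @poly_approximation R g 0 t _ cg (divr_gt0 e0 BT).
  have [F PF Ft] := Dq q.
  have b1 (w : R) : 0 <= w <= t -> `|(fun=> -1) w : R| <= 1 by rewrite normrN1.
  have PGF : primitive 0 t (fun w => (D w - q.[w]) * D w) id (fun w => G w - F w).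
    apply: second_order_ext (second_orderD PG (second_orderM b1 PF)) => s r _ _ _.
    by rewrite /=; ring.
  have DqB w : 0 <= w <= t -> `|(D w - q.[w]) * D w| <= e / (B * t + 1) * B.
    move=> wt; rewrite normrM ler_pM ?DB//; have := qP w wt.
    by rewrite gD// => /ltW.
  have := primitive_control DqB (@control_id R 0 t) PGF (lexx 0) t0 (lexx t).
  rewrite Ft /= subr0 (_ : _ - _ - _ = G t - G 0); last by ring.
  move=> /le_trans; apply.
  rewrite (_ : _ * t = e * (B * t) / (B * t + 1)); last by field; rewrite gt_eqF.
  rewrite ler_pdivrMr//.
  by rewrite ler_wpM2l ?(ltW e0)// lerDl.
have Gmono := primitive_le lDD (fun w _ => sqr_ge0 (D w)) PG.
have Gu v : u <= v -> v <= t -> G v = G u.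
  move=> uv vt; apply/le_anti; rewrite (Gmono _ _ u0 uv vt) andbT.
  rewrite (le_trans (Gmono _ _ (le_trans u0 uv) vt (lexx t)))// Gt.
  by rewrite Gmono// ltW.
case: PG => C C0 PG; apply/eqP; rewrite -sqrf_eq0 -normr_le0.
apply/ler_addgt0Pl => e e0; rewrite addr0.
have C1 : 0 < C + 1 by rewrite ltr_wpDl.
pose r := Num.min (t - u) (e / (C + 1)).
have r0 : 0 < r by rewrite lt_min subr_gt0 ut divr_gt0.
have rt : u + r <= t by rewrite -lerBrDl ge_min lexx.
have ur : u <= u + r by rewrite lerDl ltW.
have := PG u (u + r) u0 ur rt.
rewrite (Gu _ ur rt) subrr add0r normrN /= addrC addKr normrM (gtr0_norm r0).
rewrite expr2 mulrA ler_pM2r// -expr2 => /le_trans; apply.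
rewrite (@le_trans _ _ ((C + 1) * r))//.
  by rewrite ler_wpM2r ?(ltW r0)// lerDl.
by rewrite -ler_pdivlMl// mulrC ge_min lexx orbT.
Qed.

End moments.

Section separation_and_growth.
Context {R : realType} {d : nat} {T : R} {p : time_partition T}
  {x0 : 'rV[R]_d} {a : {i01 R}}.
Hypothesis T0 : 0 <= T.
Implicit Types (x y : Lambda p x0 a) (i : 'I_(1 + d)).

Definition time_letter : 'I_(1 + d) := lshift d ord0.

Lemma iterated_integral_letter x i u : 0 <= u <= T ->
  iterated_integral (stopped x) [:: i] u = coord (stopped x) i u - coord (stopped x) i 0.
Proof.
move=> u0T; have rx := stopped_regular x.
pose D w := iterated_integral (stopped x) [:: i] w - coord (stopped x) i w.
have : D u = D 0.
  apply: second_order_increment_eq u0T.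
  apply: second_order_ext (iterated_integral_primitive T0 i [::] rx) => s t _ _ _.
  by rewrite /D [iterated_integral _ [::] _]/=; ring.
rewrite /D iterated_integral_cons0 sub0r => E.
by rewrite -[LHS](subrK (coord (stopped x) i u)) E addrC.
Qed.

(** The time coordinate at [u] is [u], and its powers are shuffle products. *)
Lemma poly_comb (q : {poly R}) : exists c, forall x u, 0 <= u <= T ->
  word_comb (stopped x) c u = q.[u].
Proof.
elim/poly_ind: q => [|q r [c H]].
  by exists [::] => x u _; rewrite /word_comb big_nil horner0.
have [c' H'] := shuffle T0 c [:: (1, [:: time_letter])].
exists (c' ++ [:: (r, [::])]) => x u u0T.
rewrite word_comb_cat -H'//; last exact: stopped_regular.
rewrite H// hornerMXaddC; congr (_ * _ + _).
  rewrite /word_comb big_seq1 mul1r iterated_integral_letter// !coord_stopped_time.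
  by rewrite subr0.
by rewrite /word_comb big_seq1 mulr1.
Qed.

(** Integrating in time the product of a polynomial in time and of an increment
    of the path gives a combination of words with a single letter [i] apart from
    the letters added for time: a functional that is linear in the path. *)
Lemma moment_comb i (q : {poly R}) : exists c, forall x,
  word_comb (stopped x) c 0 = 0 /\
  primitive 0 T (fun w => q.[w] * (coord (stopped x) i w - coord (stopped x) i 0)) id
    (word_comb (stopped x) c).
Proof.
have [c H] := poly_comb q.
have [c' H'] := shuffle T0 c [:: (1, [:: i])].
exists (append_letter time_letter c') => x; have rx := stopped_regular x.
split; first exact: append_letter0.
apply: second_order_ext (append_letter_primitive T0 time_letter c' rx) => u v u0 uv vT.
have uT : 0 <= u <= T by rewrite u0 (le_trans uv).
have E : word_comb (stopped x) [:: (1, [:: i])] u =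
    coord (stopped x) i u - coord (stopped x) i 0.
  by rewrite /word_comb big_seq1 mul1r iterated_integral_letter.
by rewrite -H'// H// E !coord_stopped_time.
Qed.

Lemma stopped_eq x y : horizon x = horizon y ->
  (forall u, 0 <= u <= horizon x -> stopped x u = stopped y u) -> x = y.
Proof.
move=> txy xy; apply: dLambda_positivity; rewrite -(dLambdaxx x) /dLambda -txy subrr.
congr (_ + _).
have E u : 0 <= u -> stopped x u = stopped y u.
  move=> u0; have /andP[t0 _] := horizon_itv x.
  have := xy (Num.min u (horizon x)); rewrite le_min u0 t0 ge_min lexx orbT => /(_ isT).
  rewrite /stopped -txy -minA minxx => /eq_row_mx[_ ->]; by [].
rewrite /hoelder_dist; congr (sup _); apply: eq_imagel => -[u v] /and3P[/= u0 uv _].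
by rewrite /incr !E// ltW// (le_lt_trans u0).
Qed.

(** The difference of the paths has vanishing moments on [[0, t]], so it is zero
    on [[0, t[], and at [t] by continuity. *)
Lemma moment_separates x y : horizon x = horizon y ->
  (forall i q c, (forall z : Lambda p x0 a, word_comb (stopped z) c 0 = 0 /\
    primitive 0 T (fun w => q.[w] * (coord (stopped z) i w - coord (stopped z) i 0)) id
    (word_comb (stopped z) c)) -> sig_comb c x = sig_comb c y) -> x = y.
Proof.
move=> txy H; apply: stopped_eq => // u /andP[u0 ut]; apply/rowP => i.
set t := horizon x; have /andP[t0 tT] := horizon_itv x.
have E0 j : coord (stopped x) j 0 = coord (stopped y) j 0 by rewrite /coord !stopped0.
pose D w := coord (stopped x) i w - coord (stopped y) i w.
have lD : lip 0 t D.
  apply: (@lip_sub _ 0 T) => //.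
  have [[lx _] [ly _]] := (stopped_regular x i, stopped_regular y i).
  have := lipD lx (lipM (lip_cst 0 T (-1)) ly); congr lip.
  by apply/funext => w; rewrite mulN1r.
suff : D u = 0 by move/subr0_eq.
have Dlt w : 0 <= w < t -> D w = 0.
  apply: moments_eq0 => // q; have [c Hc] := moment_comb i q.
  exists (fun w => word_comb (stopped x) c w - word_comb (stopped y) c w); last first.
    rewrite (Hc x).1 (Hc y).1 subrr; have := H i q c Hc; rewrite /sig_comb -txy => ->.
    by rewrite subrr.
  have b1 (s : R) : 0 <= s <= T -> `|(fun=> -1) s : R| <= 1 by rewrite normrN1.
  have [C C0 HC] := second_orderD (Hc x).2 (second_orderM b1 (Hc y).2).
  exists C => // s r s0 sr rt; have := HC s r s0 sr (le_trans rt tT).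
  by congr (_ <= _); congr (`|_|); rewrite /D E0 /=; ring.
move: ut; rewrite le_eqVlt => /predU1P[ut|ut]; last by apply: Dlt; rewrite u0.
move: u0; rewrite le_eqVlt => /predU1P[<-|u0]; first by rewrite /D E0 subrr.
case: lD => L L0 DL; apply/eqP; rewrite -normr_le0.
apply/ler_addgt0Pl => e e0; rewrite addr0.
have L1 : 0 < L + 1 by rewrite ltr_wpDl.
pose r := Num.min u (e / (L + 1)).
have r0 : 0 < r by rewrite lt_min u0 divr_gt0.
have ru : r <= u by rewrite ge_min lexx.
have := DL (u - r) u; rewrite subr_ge0 ru lerBlDr lerDl (ltW r0) /t -ut lexx.
move=> /(_ isT isT isT); rewrite (Dlt (u - r)); last by rewrite subr_ge0 ru /t -ut ltrBlDr ltrDl r0.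
rewrite subr0 subKr => /le_trans; apply.
rewrite (@le_trans _ _ ((L + 1) * r))//.
  by rewrite ler_wpM2r ?(ltW r0)// lerDl.
by rewrite -ler_pdivlMl// mulrC ge_min lexx orbT.
Qed.

Variable al : {i01 R}.

Definition path_norm x : R := hoelder_norm T al%:num (stopped x).

Lemma path_norm_ge0 x : 0 <= path_norm x.
Proof.
apply: sup_image_ge0 (hoelder_norm_ubound al x) => st _.
by rewrite divr_ge0 ?powR_ge0 ?enorm_ge0.
Qed.

Lemma path_norm_incr x u v : 0 <= u -> u <= v -> v <= T ->
  enorm (incr (stopped x) u v) <= path_norm x * (v - u) `^ al%:num.
Proof.
move=> u0; rewrite le_eqVlt => /predU1P[<- _|uv vT].
  by rewrite /incr subrr enorm0 mulr_ge0 ?path_norm_ge0 ?powR_ge0.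
have vu0 : 0 < v - u by rewrite subr_gt0.
rewrite -ler_pdivrMr ?powR_gt0//.
have := ub_le_sup (hoelder_norm_ubound al x); apply.
by exists (u, v); [apply/and3P|rewrite /= gtr0_norm].
Qed.

Lemma path_norm_coord x i u : 0 <= u <= T ->
  `|coord (stopped x) i u - coord (stopped x) i 0| <= (1 + T) * path_norm x.
Proof.
move=> /andP[u0 uT].
have := normr_coord (incr (stopped x) 0 u) i; rewrite /incr entryB => /le_trans; apply.
rewrite (le_trans (path_norm_incr x (lexx 0) u0 uT))// mulrC ler_wpM2r ?path_norm_ge0//.
by rewrite subr0 powR_le1D// ?u0//; apply/andP; split.
Qed.

Lemma exprn_le_expR (h s : R) n : 0 < h -> 0 <= s -> s ^+ n <= n`!%:R / h ^+ n * expR (h * s).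
Proof.
move=> h0 s0; have hs : 0 <= h * s by rewrite mulr_ge0// ltW.
have H : (h * s) ^+ n <= n`!%:R * expR (h * s).
  case: n => [|n]; first by rewrite expr0 fact0 mul1r -expR0 ler_expR.
  have := expR_ge1Dxn n hs; rewrite -ler_pdivrMl ?ltr0n ?fact_gt0// mulrC => H.
  by apply: le_trans H; rewrite lerDr.
rewrite mulrAC ler_pdivlMr ?exprn_gt0//; apply: le_trans H.
by rewrite exprMn mulrC.
Qed.

(** Iterated integrals over a word of length [n] are bounded by the [n]-th power
    of a multiple of the Hoelder norm, which any exponential dominates. *)
Lemma sig_comb_growth (h : R) c : 0 < h -> exists C : R, forall x,
  `|sig_comb c x| <= C * expR (h * path_norm x).
Proof.
move=> h0; elim: c => [|[r J] c [C HC]].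
  by exists 0 => x; rewrite /sig_comb /word_comb big_nil normr0 mul0r.
pose K := 2 ^+ (size p).+1 * (2 * (1 + T)).
have K0 : 0 <= K by rewrite /K mulr_ge0 ?exprn_ge0// mulr_ge0// addr_ge0.
pose n := size J.
exists (`|r| * (K ^+ n * (n`!%:R / h ^+ n)) + C) => x.
rewrite /sig_comb /word_comb big_cons /= mulrDl (le_trans (ler_normD _ _))//.
rewrite lerD//; last exact: HC.
rewrite normrM -!mulrA ler_wpM2l//.
have V i : total_control_le T (K * path_norm x) (coord (stopped x) i).
  rewrite /K -!mulrA; apply: stopped_control => // u; exact: path_norm_coord.
rewrite (le_trans (iterated_integral_bound T0 J (stopped_regular x) V (horizon_itv x)))//.
rewrite exprMn ler_wpM2l ?exprn_ge0// mulrA.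
exact: exprn_le_expR (path_norm_ge0 x).
Qed.

Lemma moment_growth i q c : (forall z : Lambda p x0 a, word_comb (stopped z) c 0 = 0 /\
    primitive 0 T (fun w => q.[w] * (coord (stopped z) i w - coord (stopped z) i 0)) id
    (word_comb (stopped z) c)) ->
  exists2 C : R, 0 <= C & forall x, `|sig_comb c x| <= C * path_norm x.
Proof.
move=> Hc; have cq : continuous (fun w : R => q.[w]) by exact: continuous_horner.
have [B B0 qB] := compact_fun_bounded (@segment_compact R 0 T) cq.
exists (B * (1 + T) * T) => [|x]; first by rewrite !mulr_ge0 ?addr_ge0// ltW.
have [c0 Pc] := Hc x; have /andP[t0 tT] := horizon_itv x.
have fB w : 0 <= w <= T ->
    `|q.[w] * (coord (stopped x) i w - coord (stopped x) i 0)| <=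
    B * ((1 + T) * path_norm x).
  by move=> wT; rewrite normrM ler_pM ?path_norm_coord// qB//= in_itv.
have := primitive_control fB (@control_id R 0 T) Pc (lexx 0) t0 tT.
rewrite c0 subr0 /= subr0 => /le_trans; apply.
rewrite -[leRHS]mulrA [T * _]mulrC !mulrA ler_wpM2l//.
by rewrite !mulr_ge0 ?path_norm_ge0 ?addr_ge0// ltW.
Qed.

End separation_and_growth.

(** * Compactness of Hoelder balls of stopped paths *)

Lemma powR_small {R : realType} (c e : R) : 0 < c -> 0 < e ->
  exists2 rho : R, 0 < rho & forall s, 0 <= s -> s <= rho -> s `^ c <= e.
Proof.
move=> c0 e0; exists (e `^ c^-1); first exact: powR_gt0.
move=> s s0 sr; rewrite -[leRHS](powRr1 (ltW e0)) -(mulVf (lt0r_neq0 c0)) powRrM.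
by apply: ge0_ler_powR; rewrite ?nnegrE ?powR_ge0// ltW.
Qed.

(** An ultrafilter converges along a bounded real function: a cluster value
    exists by compactness, and every neighbourhood of it or its complement
    belongs to the image. *)
Lemma ultra_bounded_limit {R : realType} {S : Type} (F : set_system S) (g : S -> R) (M : R) :
  UltraFilter F -> (\forall z \near F, `|g z| <= M) ->
  exists l, forall e : R, 0 < e -> \forall z \near F, `|g z - l| <= e.
Proof.
move=> UF gM; have PF : ProperFilter F by exact: ultra_proper.
have FM : (g @ F) `[- M, M]%classic.
  by apply: filterS gM => z /=; rewrite in_itv/= ler_norml.
have [l [_ cl]] := @segment_compact R (- M) M (g @ F) _ FM.
exists l => e e0; have [//|FC] := in_ultra_setVsetC [set z | `|g z - l| <= e] UF.
have nl : nbhs l (ball l e) by exact: nbhsx_ballx.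
have FgC : (g @ F) (~` [set r | `|r - l| <= e]) by exact: FC.
have [r [/= rl]] := cl _ _ FgC nl; rewrite /ball/= distrC => /ltW.
by move=> /rl.
Qed.

Lemma le0_le_eps {R : realType} (x K : R) : 0 <= K ->
  (forall e : R, 0 < e -> x <= K * e) -> x <= 0.
Proof.
move=> K0 H; apply/ler_addgt0Pl => e e0; rewrite addr0.
have K1 : 0 < K + 1 by rewrite ltr_wpDl.
rewrite (le_trans (H _ (divr_gt0 e0 K1)))// mulrA ler_pdivrMr// mulrC.
by rewrite ler_wpM2l ?(ltW e0)// lerDl.
Qed.

Lemma pl_interp_ext {R : realType} {d : nat} (X X' : R -> 'rV[R]_d) c s :
  (forall b, b \in c :: s -> X b = X' b) ->
  pl_interp X c s =1 pl_interp X' c s.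
Proof.
elim: s c => [|h s IH] c XX u /=; first by rewrite XX// mem_head.
have Xc : X c = X' c by rewrite XX// mem_head.
have Xh : X h = X' h by rewrite XX// !inE eqxx orbT.
rewrite Xc Xh; case: leP => // _; apply: IH => b bs.
by rewrite XX// inE bs orbT.
Qed.

(** The values of [X] at the points of [s] up to [t] are those of [h]; at the first
    point after [t] the value is obtained by prolonging the last affine piece
    linearly beyond [t]. *)
Lemma pl_interp_rebuild {R : realType} {d : nat} (h : R -> 'rV[R]_d) (c b t : R) s :
  itv_partition c b s -> c <= t <= b ->
  (forall i u v, c <= u -> u <= v -> v <= t ->
    (forall e, e \in s -> ~~ (u < e < v)) -> affine_on (fun w => h w 0 i) u v) ->
  exists2 X, X c = h c & forall u, c <= u <= t -> pl_interp X c s u = h u.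
Proof.
elim: s c => [|f s IH] c cbs /andP[ct tb] hs.
  exists h => // u /andP[cu ut] /=; congr h; apply/le_anti.
  by rewrite cu (le_trans ut)// (le_trans tb)// (itv_partition_nil cbs).
have fbs := itv_partition_cons cbs.
have cf : c < f by case: cbs => /= /andP[].
have sf e : e \in s -> f < e.
  by case: cbs => /= /andP[_]; rewrite lt_path_sortedE => /andP[/allP H _] _ /H.
have [tf|ft] := leP t f.
  pose X w := if w == c then h c else
    if t == c then h c else h c + ((f - c) / (t - c)) *: (h t - h c).
  exists X => [|u /andP[cu ut]]; first by rewrite /X eqxx.
  rewrite /= (le_trans ut tf) /X eqxx gt_eqF//.
  have [tc|tc] := eqVneq t c.
    by rewrite subrr scaler0 addr0; congr h; apply/le_anti; rewrite cu -tc ut.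
  have ct' : 0 < t - c by rewrite subr_gt0 lt_def tc ct.
  have fc' : f - c != 0 by rewrite subr_eq0 gt_eqF.
  apply/rowP => i; rewrite !mxE.
  have := hs i c t (lexx c) ct (lexx t) _ u; rewrite cu ut => /(_ _ isT) E.
  apply: (mulfI (lt0r_neq0 ct')); rewrite E.
    by field; rewrite fc' gt_eqF.
  move=> e; rewrite inE => /predU1P[->|/sf fe]; first by rewrite [f < t]ltNge tf andbF.
  by rewrite [e < t]ltNge (le_trans tf (ltW fe)) andbF.
have [||X Xf XP] := IH f fbs.
- by rewrite (ltW ft).
- move=> i u v fu uv vt H; apply: hs => //; first by rewrite (le_trans (ltW cf)).
  by move=> e; rewrite inE => /predU1P[->|]; [rewrite ltNge fu|exact: H].
pose X' w := if w == c then h c else X w.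
have X'E w : c < w -> X' w = X w by move=> cw; rewrite /X' gt_eqF.
exists X' => [|u /andP[cu ut]]; first by rewrite /X' eqxx.
have [fu|uf] := leP f u.
  rewrite (pl_interp_tail _ fbs cf fu) -XP ?fu//.
  apply: pl_interp_ext => e; rewrite inE => /predU1P[->|/sf fe]; rewrite X'E//.
  exact: lt_trans fe.
have X'c : X' c = h c by rewrite /X' eqxx.
rewrite /= (ltW uf) X'c (X'E f cf) Xf; apply/rowP => i; rewrite !mxE.
have fc' : 0 < f - c by rewrite subr_gt0.
have := hs i c f (lexx c) (ltW cf) (ltW ft) _ u; rewrite cu (ltW uf) => /(_ _ isT) E.
apply: (mulfI (lt0r_neq0 fc')); rewrite E.
  by field; rewrite gt_eqF.
move=> e; rewrite inE => /predU1P[->|/sf fe]; first by rewrite ltxx andbF.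
by rewrite [e < f]ltNge (ltW fe) andbF.
Qed.

Section sublevel_compactness.
Context {R : realType} {d : nat} {T : R} {p : time_partition T}
  {x0 : 'rV[R]_d} {a : {i01 R}} {al : {i01 R}}.
Hypothesis T0 : 0 < T.
Hypothesis a_al : a%:num < al%:num.
Implicit Types (x y z : Lambda p x0 a) (i : 'I_(1 + d)).
Variable r : R.

Let al0 : 0 < al%:num.
Proof. by apply: le_lt_trans a_al. Qed.

Lemma coord_increment z i u v : path_norm al z <= r -> 0 <= u <= T -> 0 <= v <= T ->
  `|coord (stopped z) i v - coord (stopped z) i u| <= r * `|v - u| `^ al%:num.
Proof.
move=> zr; wlog uv : u v / u <= v.
  move=> H u0T v0T; have [uv|/ltW vu] := leP u v; first exact: H.
  by rewrite distrC (distrC v) H.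
move=> /andP[u0 uT] /andP[v0 vT]; rewrite [`|v - u|]ger0_norm ?subr_ge0//.
have := normr_coord (incr (stopped z) u v) i; rewrite /incr entryB => /le_trans; apply.
by rewrite (le_trans (path_norm_incr al z u0 uv vT))// ler_wpM2r ?powR_ge0.
Qed.

Lemma enorm_le_sum (m : nat) (v : 'rV[R]_m) : enorm v <= \sum_i `|v 0 i|.
Proof.
have s0 : 0 <= \sum_i `|v 0 i| by apply: sumr_ge0.
rewrite -(@ler_pXn2r _ 2) ?nnegrE ?enorm_ge0// sqr_enorm.
rewrite expr2 mulr_suml; apply: ler_sum => i _.
rewrite -real_normK ?num_real// expr2 ler_wpM2l// (bigD1 i)//= lerDl.
exact: sumr_ge0.
Qed.

(** Throughout the section, [F] is an ultrafilter of stopped paths of norm at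
    most [r], along which coordinates converge pointwise to [h] and horizons
    converge to [t]. *)
Section pointwise_limit.
Variable F : set_system (Lambda p x0 a).
Hypotheses (UF : UltraFilter F) (FK : F [set z | path_norm al z <= r]).
Variables (h : 'I_(1 + d) -> R -> R) (t : R).
Hypothesis hP : forall i u, 0 <= u <= T -> forall e : R, 0 < e ->
  \forall z \near F, `|coord (stopped z) i u - h i u| <= e.
Hypothesis tP : forall e : R, 0 < e -> \forall z \near F, `|horizon z - t| <= e.

Let PF : ProperFilter F. Proof. exact: ultra_proper. Qed.

Let r0 : 0 <= r.
Proof. by have [z /=] := filter_ex FK; apply: le_trans; exact: path_norm_ge0. Qed.

Lemma limit_horizon_itv : 0 <= t <= T.
Proof.
have H (e : R) : 0 < e -> - e <= t <= T + e.
  move=> e0; near F => z; have /andP[z0 zT] := horizon_itv z.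
  have : `|horizon z - t| <= e by near: z; exact: tP.
  by rewrite ler_norml => /andP[? ?]; apply/andP; split; lra.
apply/andP; split.
  by rewrite -oppr_le0; apply/ler_addgt0Pl => e /H /andP[? _]; lra.
by apply/ler_addgt0Pl => e /H /andP[_ ?]; lra.
Unshelve. all: by end_near. Qed.

Lemma limit_time k u : 0 <= u <= T -> h (lshift d k) u = u.
Proof.
move=> u0T; apply/eqP; rewrite -subr_eq0 -normr_le0.
apply: (@le0_le_eps _ _ 1) => // e e0; rewrite mul1r; near F => z.
have : `|coord (stopped z) (lshift d k) u - h (lshift d k) u| <= e by near: z; exact: hP.
by rewrite coord_stopped_time distrC.
Unshelve. all: by end_near. Qed.

Lemma limit_start i : h i 0 = (row_mx 0 x0 : 'rV_(1 + d)) 0 i.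
Proof.
apply/eqP; rewrite -subr_eq0 -normr_le0.
apply: (@le0_le_eps _ _ 1) => // e e0; rewrite mul1r; near F => z.
have : `|coord (stopped z) i 0 - h i 0| <= e.
  by near: z; apply: hP; rewrite // lexx ltW.
by rewrite /coord stopped0 distrC.
Unshelve. all: by end_near. Qed.

Lemma limit_increment i u v : 0 <= u <= T -> 0 <= v <= T ->
  `|h i v - h i u| <= r * `|v - u| `^ al%:num.
Proof.
move=> u0T v0T; rewrite -subr_le0; apply: (@le0_le_eps _ _ 2) => // e e0; near F => z.
have zu : `|coord (stopped z) i u - h i u| <= e by near: z; exact: hP.
have zv : `|coord (stopped z) i v - h i v| <= e by near: z; exact: hP.
have zr : path_norm al z <= r by near: z.
have := coord_increment i zr u0T v0T; rewrite lerBlDl; move: zu zv.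
rewrite !ler_norml => /andP[? ?] /andP[? ?] /andP[? ?].
by apply/andP; split; lra.
Unshelve. all: by end_near. Qed.

(** A path [z] is constant after its own horizon, which is close to [t] but may
    lie on either side; the Hoelder bound makes the resulting error small. *)
Lemma limit_stopped (i : 'I_d) u : 0 <= u <= T -> h (rshift 1 i) u = h (rshift 1 i) (Num.min u t).
Proof.
move=> /andP[u0 uT]; have /andP[t0 tT] := limit_horizon_itv.
have [ut|tu] := leP u t; first by [].
apply/eqP; rewrite -subr_eq0 -normr_le0.
apply: (@le0_le_eps _ _ (2 + r)) => [|e e0]; first by rewrite addr_ge0.
have [rho rho0 small] := powR_small al0 e0; near F => z.
have zu : `|coord (stopped z) (rshift 1 i) u - h (rshift 1 i) u| <= e.
  by near: z; apply: hP => //; rewrite u0.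
have zt : `|coord (stopped z) (rshift 1 i) t - h (rshift 1 i) t| <= e.
  by near: z; apply: hP => //; rewrite t0.
have zr : path_norm al z <= r by near: z.
have tzt : `|horizon z - t| <= rho by near: z; exact: tP.
have /andP[s0 sT] := horizon_itv z.
have zE w : coord (stopped z) (rshift 1 i) w =
    coord (stopped z) (rshift 1 i) (Num.min w (horizon z)).
  by rewrite /coord /stopped !row_mxEr -minA minxx.
have zut : `|coord (stopped z) (rshift 1 i) u - coord (stopped z) (rshift 1 i) t| <= r * e.
  rewrite (zE u) (zE t) (le_trans (coord_increment _ zr _ _))//.
  - by rewrite le_min t0 s0 ge_min tT.
  - by rewrite le_min u0 s0 ge_min uT.
  rewrite ler_wpM2l// small// (le_trans _ tzt)//.
  case: (leP u (horizon z)) => ?; case: (leP t (horizon z)) => ?;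
  rewrite ?subrr ?normr0//; rewrite ?ger0_norm; lra.
move: zu zt zut; rewrite !ler_norml => /andP[? ?] /andP[? ?] /andP[? ?].
by apply/andP; split; lra.
Unshelve. all: by end_near. Qed.

(** For [v < t] the horizon of [z] eventually exceeds [v], so it is not a break
    point inside the interval. *)
Lemma limit_affine_lt i u v : 0 <= u -> u <= v -> v < t ->
  (forall e, e \in (p : seq R) -> ~~ (u < e < v)) -> affine_on (h i) u v.
Proof.
move=> u0 uv vt H w /andP[uw wv]; have /andP[t0 tT] := limit_horizon_itv.
have vT : v <= T by rewrite (le_trans (ltW vt)).
apply/eqP; rewrite -subr_eq0 -normr_le0.
pose K := (v - u) + (v - w) + (w - u).
have K0 : 0 <= K by rewrite /K; lra.
apply: (@le0_le_eps _ _ K) => // e e0.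
have tv0 : 0 < t - v by rewrite subr_gt0.
near F => z.
have zu : `|coord (stopped z) i u - h i u| <= e.
  by near: z; apply: hP => //; rewrite u0 (le_trans uv).
have zv : `|coord (stopped z) i v - h i v| <= e.
  by near: z; apply: hP => //; rewrite (le_trans u0 uv).
have zw : `|coord (stopped z) i w - h i w| <= e.
  by near: z; apply: hP => //; rewrite (le_trans u0 uw) (le_trans wv).
have tz : `|horizon z - t| <= t - v by near: z; exact: tP.
have Ez : (v - u) * coord (stopped z) i w =
    (v - w) * coord (stopped z) i u + (w - u) * coord (stopped z) i v.
  apply: (@stopped_piecewise_affine _ _ _ _ _ _ z i u v u0 uv vT); last by rewrite uw.
  move=> c; rewrite inE => /predU1P[->|]; last exact: H.
  rewrite [_ < v]ltNge negb_and negbK; apply/orP; right.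
  by move: tz; rewrite ler_norml => /andP[? ?]; lra.
rewrite (_ : _ - _ = (v - w) * (coord (stopped z) i u - h i u) +
  (w - u) * (coord (stopped z) i v - h i v) - (v - u) * (coord (stopped z) i w - h i w)
  ); last by rewrite !mulrBr Ez; ring.
rewrite (le_trans (ler_normB _ _))// (le_trans (lerD (ler_normD _ _) (lexx _)))//.
rewrite !normrM [`|v - w|]ger0_norm ?subr_ge0// [`|w - u|]ger0_norm ?subr_ge0//.
rewrite [`|v - u|]ger0_norm ?subr_ge0//.
have := ler_wpM2l (_ : 0 <= v - w) zu; rewrite subr_ge0 => /(_ wv).
have := ler_wpM2l (_ : 0 <= w - u) zv; rewrite subr_ge0 => /(_ uw).
have := ler_wpM2l (_ : 0 <= v - u) zw; rewrite subr_ge0 => /(_ uv).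
by rewrite /K !mulrDl; lra.
Unshelve. all: by end_near. Qed.

(** The remaining case [v = t] follows by letting the right end point tend
    to [t]. *)
Lemma limit_affine i u v : 0 <= u -> u <= v -> v <= t ->
  (forall e, e \in (p : seq R) -> ~~ (u < e < v)) -> affine_on (h i) u v.
Proof.
move=> u0 uv; rewrite le_eqVlt => /predU1P[vt H|]; last exact: limit_affine_lt.
move=> w /andP[uw]; rewrite le_eqVlt => /predU1P[->|wv]; first by ring.
have /andP[t0 tT] := limit_horizon_itv.
have vT : v <= T by rewrite vt.
apply/eqP; rewrite -subr_eq0 -normr_le0.
pose K := `|h i w - h i u| + T * r.
have K0 : 0 <= K by rewrite addr_ge0// mulr_ge0// ltW.
apply: (@le0_le_eps _ _ K) => // e e0.
have [rho rho0 small] := powR_small al0 e0.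
(* A time in [[w, t[[ close to [t], where [limit_affine_lt] applies. *)
pose s := Num.max w (v - Num.min rho e).
have m0 : 0 < Num.min rho e by rewrite lt_min rho0.
have ws : w <= s by rewrite le_max lexx.
have sv : s < v by rewrite gt_max wv ltrBlDr ltrDl.
have svm : v - s <= Num.min rho e by rewrite lerBlDr -lerBlDl le_max lexx orbT.
move: svm; rewrite le_min => /andP[svr sve].
have us := le_trans uw ws.
have As : affine_on (h i) u s.
  apply: limit_affine_lt => //; first by rewrite -vt.
  by move=> c /H; apply: contra => /andP[-> cs]; rewrite (lt_trans cs).
have Es : (s - u) * h i w = (s - w) * h i u + (w - u) * h i s.
  by apply: As; rewrite uw.
have hs : `|h i v - h i s| <= r * e.
  rewrite (le_trans (limit_increment _ _ _))//.
  - by rewrite (le_trans u0 us) (le_trans (ltW sv)).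
  - by rewrite (le_trans u0 uv).
  rewrite ler_wpM2l// small//.
  by rewrite ger0_norm// subr_ge0 ltW.
rewrite (_ : _ - _ = (v - s) * (h i w - h i u) - (w - u) * (h i v - h i s)); last first.
  have -> : v - u = (v - s) + (s - u) by ring.
  by rewrite mulrDl Es; ring.
rewrite (le_trans (ler_normB _ _))// !normrM.
rewrite [`|v - s|]ger0_norm ?subr_ge0 ?(ltW sv)// [`|w - u|]ger0_norm ?subr_ge0//.
rewrite /K [leRHS]mulrDl lerD//; first by rewrite mulrC ler_wpM2l.
rewrite -mulrA ler_pM ?subr_ge0//; lra.
Qed.

Lemma limit_path : exists x, horizon x = t /\
  forall i u, 0 <= u <= T -> coord (stopped x) i u = h i u.
Proof.
have /andP[t0 tT] := limit_horizon_itv.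
pose hs u : 'rV[R]_d := \row_k h (rshift 1 k) u.
have [||X X0 XP] := @pl_interp_rebuild R d hs 0 T t p (pointsP p).
- by rewrite t0.
- move=> i u v u0 uv vt H w uwv; rewrite /hs !mxE.
  exact: limit_affine H w uwv.
have X0' : X 0 = x0.
  by rewrite X0; apply/rowP => k; rewrite mxE limit_start row_mxEr.
pose Y := (t, time_extend (pl_interp X 0 p) \_ `[0, t]).
have Yin : stopped_paths p x0 Y.
  exists t; first by rewrite /= in_itv/= t0.
  by exists (time_extend (pl_interp X 0 p)) => //; exists X.
pose x : Lambda p x0 a := SigSub (mem_set Yin).
have tx : horizon x = t by [].
have xE : path_of x = time_extend (pl_interp X 0 p) \_ `[0, horizon x] by [].
exists x; split=> // i u /andP[u0 uT].
rewrite /coord (@stoppedE _ _ _ _ _ _ x X u _ xE u0) ?tx//.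
rewrite /time_extend /=; case: (split_ordP i) => k ->.
  by rewrite row_mxEl ord1 mxE eqxx mulr1n limit_time// u0.
rewrite row_mxEr XP; last by rewrite le_min u0 t0 ge_min lexx orbT.
by rewrite mxE -limit_stopped// u0.
Qed.

Lemma limit_norm x : (forall i u, 0 <= u <= T -> coord (stopped x) i u = h i u) ->
  path_norm al x <= r.
Proof.
move=> xh; apply: ge_sup.
  by exists (enorm (incr (stopped x) 0 T) / (`|T - 0| `^ al%:num)), (0, T) => //; apply/and3P.
move=> _ [[u v] /and3P[/= u0 uv vT] <-].
have vu : 0 < v - u by rewrite subr_gt0.
have u0T : 0 <= u <= T by rewrite u0 (le_trans (ltW uv)).
have v0T : 0 <= v <= T by rewrite (le_trans u0 (ltW uv)).
rewrite gtr0_norm// ler_pdivrMr ?powR_gt0// -subr_le0.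
apply: (@le0_le_eps _ _ (\sum_(i < 1 + d) 2)) => [|e e0]; first by apply: sumr_ge0.
near F => z.
have zu : forall i, `|coord (stopped z) i u - h i u| <= e.
  by near: z; apply: filter_forall => i; exact: hP.
have zv : forall i, `|coord (stopped z) i v - h i v| <= e.
  by near: z; apply: filter_forall => i; exact: hP.
have zr : path_norm al z <= r by near: z.
rewrite lerBlDl -(subrKC (incr (stopped z) u v) (incr (stopped x) u v)).
rewrite (le_trans (ler_enormD _ _))// lerD//.
  rewrite (le_trans (path_norm_incr al z u0 (ltW uv) vT))//.
  by rewrite ler_wpM2r ?powR_ge0.
rewrite (le_trans (enorm_le_sum _))// mulr_suml; apply: ler_sum => i _.
rewrite entryB /incr !entryB -!/(coord _ _ _) !xh//.
have := zu i; have := zv i; rewrite !ler_norml => /andP[? ?] /andP[? ?].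
by apply/andP; split; lra.
Unshelve. all: by end_near. Qed.

(** Equicontinuity spreads closeness at [u] to a neighbourhood of [u], and the
    compactness of [[0, T]] makes it uniform. *)
Lemma limit_uniform x : (forall i u, 0 <= u <= T -> coord (stopped x) i u = h i u) ->
  forall e : R, 0 < e -> \forall z \near F, forall u, 0 <= u <= T -> forall i,
  `|coord (stopped x) i u - coord (stopped z) i u| <= e.
Proof.
move=> xh e e0; have xr := limit_norm xh.
have D0 : 0 < 1 + 2 * r by rewrite ltr_pwDl// mulr_ge0.
pose e' := e / (1 + 2 * r); have e'0 : 0 < e' by rewrite divr_gt0.
have [rho rho0 small] := powR_small al0 e'0.
have := @segment_compact R 0 T; rewrite compact_near_coveringP => cov.
have : \forall z \near F, forall u, `[0, T]%classic u -> forall i,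
    0 <= u <= T -> `|coord (stopped x) i u - coord (stopped z) i u| <= e.
  apply: (cov _ F (fun z u => forall i, 0 <= u <= T ->
    `|coord (stopped x) i u - coord (stopped z) i u| <= e)) => u.
  rewrite /= in_itv/= => u0T; near=> v z => i v0T.
  have zu : forall i, `|coord (stopped z) i u - h i u| <= e'.
    by near: z; apply: filter_forall => j; exact: hP.
  have zr : path_norm al z <= r by near: z.
  have uv : `|u - v| <= rho.
    by near: v; apply: cvgr_dist_le => //; exact: cvg_id.
  have small' : `|v - u| `^ al%:num <= e' by rewrite distrC small.
  have := coord_increment i zr u0T v0T; have := coord_increment i xr u0T v0T.
  have := zu i; rewrite -xh// => H1 H2 H3.
  have {}H2 := le_trans H2 (ler_wpM2l r0 small').
  have {}H3 := le_trans H3 (ler_wpM2l r0 small').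
  have -> : e = e' + r * e' + r * e' by rewrite /e'; field; rewrite gt_eqF.
  move: H1 H2 H3; rewrite !ler_norml => /andP[? ?] /andP[? ?] /andP[? ?].
  by apply/andP; split; lra.
apply: filterS => z H u u0T i; exact: H.
Unshelve. all: by end_near. Qed.

(** For close times the increments of both paths are [O((v - u) ^ al)], which is
    small compared with [(v - u) ^ a]; for distant times uniform closeness
    suffices. *)
Lemma limit_cvg x : horizon x = t ->
  (forall i u, 0 <= u <= T -> coord (stopped x) i u = h i u) -> F --> x.
Proof.
move=> tx xh U /Lambda_nbhsP[e e0 eU]; have xr := limit_norm xh.
have e40 : 0 < e / 4 by rewrite divr_gt0.
have c0 : 0 < al%:num - a%:num by rewrite subr_gt0.
have D0 : 0 < 2 * r + 1 by rewrite ltr_wpDl// mulr_ge0.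
have [rho rho0 small] := powR_small c0 (divr_gt0 e40 D0).
pose n : R := \sum_(i < 1 + d) 2.
have n0 : 0 < n by rewrite /n big_ord_recl ltr_pwDl// sumr_ge0.
(* Uniform closeness for which increments over times longer than [rho] differ
   by at most [e / 4 * rho ^ a]; [n] comes from the norm equivalence. *)
pose delta := e / 4 * rho `^ a%:num / n.
have d0 : 0 < delta by rewrite !divr_gt0// mulr_gt0// powR_gt0.
near=> z; apply: eU.
have zr : path_norm al z <= r by near: z.
have tz : `|horizon z - t| <= e / 4 by near: z; exact: tP.
have unif : forall u, 0 <= u <= T -> forall i,
   `|coord (stopped x) i u - coord (stopped z) i u| <= delta.
  by near: z; exact: limit_uniform.
suff : hoelder_dist T a%:num (stopped x) (stopped z) <= e / 4.
  by rewrite /dLambda tx distrC; lra.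
apply: ge_sup.
  by eexists; exists (0, T) => //; apply/and3P.
move=> _ [[u v] /and3P[/= u0 uv vT] <-].
have vu : 0 < v - u by rewrite subr_gt0.
have u0T : 0 <= u <= T by rewrite u0 (le_trans (ltW uv)).
have v0T : 0 <= v <= T by rewrite (le_trans u0 (ltW uv)).
rewrite gtr0_norm// ler_pdivrMr ?powR_gt0//.
have [close|far] := leP (v - u) rho.
  have xz : enorm (incr (stopped x) u v - incr (stopped z) u v) <=
      2 * r * (v - u) `^ al%:num.
    rewrite (le_trans (ler_enormD _ _))// enormN -mulrA mulr2n mulrDl mul1r.
    by rewrite lerD// (le_trans (path_norm_incr al _ u0 (ltW uv) vT))// ler_wpM2r ?powR_ge0.
  rewrite (le_trans xz)//.
  have -> : (v - u) `^ al%:num = (v - u) `^ (al%:num - a%:num) * (v - u) `^ a%:num.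
    rewrite -powRD ?subrK//; apply/implyP => _.
    exact: lt0r_neq0.
  rewrite mulrA ler_wpM2r ?powR_ge0//.
  rewrite (@le_trans _ _ ((2 * r + 1) * (e / 4 / (2 * r + 1))))//.
    by rewrite ler_pM ?mulr_ge0 ?powR_ge0 ?lerDl// small// ltW.
  by rewrite mulrC divfK// gt_eqF.
rewrite (le_trans (enorm_le_sum _))//.
apply: (@le_trans _ _ (n * delta)).
  rewrite /n mulr_suml; apply: ler_sum => i _.
  rewrite /incr !entryB -!/(coord _ _ _).
  have := unif u u0T i; have := unif v v0T i.
  by rewrite !ler_norml => /andP[? ?] /andP[? ?]; apply/andP; split; lra.
rewrite /delta mulrC divfK ?gt_eqF// ler_wpM2l ?(ltW e40)//.
by apply: ge0_ler_powR; rewrite ?nnegrE// ltW.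
Unshelve. all: by end_near. Qed.

End pointwise_limit.

Lemma sublevel_compact : compact [set x : Lambda p x0 a | path_norm al x <= r].
Proof.
rewrite compact_ultra => F UF FK.
have hex (iu : 'I_(1 + d) * R) : exists l, 0 <= iu.2 <= T -> forall e : R, 0 < e ->
    \forall z \near F, `|coord (stopped z) iu.1 iu.2 - l| <= e.
  case: iu => i u /=; have [u0T|] := boolP (0 <= u <= T); last by exists 0.
  pose M := `|(row_mx 0 x0 : 'rV_(1 + d)) 0 i| + (1 + T) * r.
  have PF : ProperFilter F by exact: ultra_proper.
  have [|l lP] := @ultra_bounded_limit R _ F (fun z => coord (stopped z) i u) M UF.
    apply: filterS FK => z /= zr; have := path_norm_coord (ltW T0) al z i u0T.
    rewrite {2}/coord stopped0 => H.
    rewrite -(subrK ((row_mx 0 x0 : 'rV_(1 + d)) 0 i) (coord _ _ _)).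
    rewrite (le_trans (ler_normD _ _))// addrC lerD2l (le_trans H)// ler_wpM2l//.
    by rewrite addr_ge0// ltW.
  by exists l => _.
have [h hP] := choice hex.
have PF : ProperFilter F by exact: ultra_proper.
have hT : \forall z \near F, `|horizon z| <= T.
  by apply: filterS FK => z _; have /andP[? ?] := horizon_itv z; rewrite ger0_norm.
have [t tP] := ultra_bounded_limit UF hT.
have [x [tx xh]] := limit_path UF FK (h := fun i u => h (i, u)) (fun i u => hP (i, u)) tP.
exists x; split.
  exact: (limit_norm UF FK (fun i u => hP (i, u)) xh).
exact: (limit_cvg UF FK (fun i u => hP (i, u)) tP tx xh).
Qed.

End sublevel_compactness.

(** * Density of the signature functionals *)

Section weighted_signature.
Context {R : realType} {d : nat} {T : R} {p : time_partition T}
  {x0 : 'rV[R]_d} {a : {i01 R}} {al : {i01 R}}.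
Variables (beta gamma : R).
Hypotheses (T0 : 0 < T) (a_al : a%:num < al%:num) (b0 : 0 < beta) (g1 : 1 <= gamma).
Implicit Types (x y z : Lambda p x0 a) (i : 'I_(1 + d)).

Let psi : Lambda p x0 a -> R := exp_weight al%:num beta gamma.

Let g0 : 0 < gamma. Proof. exact: lt_le_trans g1. Qed.

Lemma exp_weight_ge1 x : 1 <= psi x.
Proof. by rewrite -expR0 ler_expR mulr_ge0 ?powR_ge0// ltW. Qed.

(** [s <= 1 + s ^ gamma] for [s >= 0], so the weight dominates an exponential of
    the norm itself. *)
Lemma exp_weight_ge x : expR (beta * path_norm al x) <= expR beta * psi x.
Proof.
rewrite -expRD ler_expR -[X in X + _]mulr1 -mulrDr ler_wpM2l ?(ltW b0)//.
rewrite -/(path_norm al x); set s := path_norm al x.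
have s0 : 0 <= s by exact: path_norm_ge0.
have := powR_ge0 s gamma; have [s1|s1] := leP 1 s; last by lra.
by have := ler_powR s1 g1; rewrite powRr1//; lra.
Qed.

Lemma exp_weight_sublevel (r : R) : 1 <= r -> [set x | psi x <= r] =
  [set x : Lambda p x0 a | path_norm al x <= (ln r / beta) `^ gamma^-1].
Proof.
move=> r1; have rp : 0 < r by exact: lt_le_trans r1.
have lr : 0 <= ln r / beta by rewrite divr_ge0 ?ln_ge0// ltW.
apply/seteqP; split=> x; rewrite /= /psi /exp_weight -/(path_norm al x).
  rewrite -{1}[r]lnK ?posrE// ler_expR -ler_pdivlMl// mulrC => H.
  have s0 := path_norm_ge0 al x.
  rewrite -[leLHS](powRr1 s0) -(divff (lt0r_neq0 g0)) powRrM.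
  by apply: ge0_ler_powR; rewrite ?nnegrE ?powR_ge0 ?invr_ge0// ltW.
move=> H; rewrite -[leRHS]lnK ?posrE// ler_expR -ler_pdivlMl// mulrC.
have s0 := path_norm_ge0 al x.
rewrite -[leRHS](powRr1 lr) -(mulVf (lt0r_neq0 g0)) powRrM.
by apply: ge0_ler_powR; rewrite ?nnegrE ?powR_ge0// ltW.
Qed.

Lemma exp_weight_sublevel_compact (r : R) : compact [set x | psi x <= r].
Proof.
have [r1|r1] := leP 1 r.
  by rewrite exp_weight_sublevel//; exact: sublevel_compact.
rewrite (_ : [set _ | _] = set0); first exact: compact0.
apply/seteqP; split=> x //= xr; have := exp_weight_ge1 x.
by rewrite leNgt (le_lt_trans xr).
Qed.

Lemma exp_weight_admissible : admissible_weight psi.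
Proof.
split=> [x|r _]; first exact: expR_gt0.
rewrite (_ : _ @^-1` _ = [set x | psi x <= r]); first exact: exp_weight_sublevel_compact.
by apply/seteqP; split=> x /=; rewrite in_itv/= expR_gt0.
Qed.

(** Half of the rate [beta] dominates the polynomial growth of the combination
    [c]; the other half absorbs the exponential of [h * |sig_comb c'|]. *)
Lemma sig_comb_exp_growth (c' : seq (R * seq 'I_(1 + d))) (C1 C2 : R) : 0 <= C2 ->
  (forall x : Lambda p x0 a, `|sig_comb c' x| <= C1 + C2 * path_norm al x) ->
  exists2 h : R, 0 < h & forall c, exists C : R, forall x : Lambda p x0 a,
    `|sig_comb c x| * expR (h * `|sig_comb c' x|) <= C * psi x.
Proof.
move=> C20 Hc'; have C21 : 0 < C2 + 1 by rewrite ltr_wpDl.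
(* The rate [h * C2] stays below [beta / 2]. *)
pose h := beta / 2 / (C2 + 1); have h0 : 0 < h by rewrite !divr_gt0.
have b20 : 0 < beta / 2 by rewrite divr_gt0.
exists h => // c.
have [C HC] := sig_comb_growth (p := p) (x0 := x0) (a := a) (ltW T0) al c b20.
exists (C * expR (h * C1) * expR beta) => x; have s0 := path_norm_ge0 al x.
have C0 : 0 <= C by rewrite -(pmulr_lge0 _ (expR_gt0 (beta / 2 * path_norm al x))) (le_trans _ (HC x)).
rewrite -mulrA (le_trans _ (ler_wpM2l _ (exp_weight_ge x)))// ?mulr_ge0 ?expR_ge0//.
apply: (@le_trans _ _ (C * expR (beta / 2 * path_norm al x) *
    (expR (h * C1) * expR (beta / 2 * path_norm al x)))).
  rewrite ler_pM ?expR_ge0// -expRD ler_expR.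
  rewrite (le_trans (ler_wpM2l (ltW h0) (Hc' x)))// mulrDr lerD2l mulrA ler_wpM2r//.
  by rewrite /h mulrAC ler_pdivrMr// ler_wpM2l ?(ltW b20)// lerDl.
by rewrite mulrACA -expRD -mulrDl -splitr.
Qed.

Lemma sig_comb_weight_bound (c : seq (R * seq 'I_(1 + d))) :
  exists C : R, forall x : Lambda p x0 a, `|sig_comb c x| <= C * psi x.
Proof.
have [C HC] := sig_comb_growth (p := p) (x0 := x0) (a := a) (ltW T0) al c b0.
exists (C * expR beta) => x; rewrite -mulrA (le_trans (HC x))//.
have C0 : 0 <= C by rewrite -(pmulr_lge0 _ (expR_gt0 (beta * path_norm al x))) (le_trans _ (HC x)).
by rewrite ler_wpM2l ?exp_weight_ge.
Qed.

Definition sig_functions : set (Lambda p x0 a -> R) := range sig_comb.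

Lemma sig_functions_algebra : function_algebra sig_functions.
Proof.
split=> [r|_ _ [c _ <-] [c' _ <-]|_ _ [c _ <-] [c' _ <-]].
- exists [:: (r, [::])] => //; apply/funext => x.
  by rewrite /sig_comb /word_comb big_seq1 mulr1.
- exists (c ++ c') => //; apply/funext => x; exact: word_comb_cat.
have [c'' H] := shuffle (ltW T0) c c'; exists c'' => //; apply/funext => x.
by rewrite /= /sig_comb H ?horizon_itv//; exact: (stopped_regular x).
Qed.

Lemma sig_functions_sum (J : Type) (s : seq J) (f : J -> Lambda p x0 a -> R) :
  (forall k, sig_functions (f k)) -> sig_functions (fun x => \sum_(k <- s) f k x).
Proof.
move=> Hf; elim: s => [|k s IH].
  rewrite (_ : (fun _ => _) = cst 0); first exact: (algebra_cst sig_functions_algebra).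
  by apply/funext => x; rewrite big_nil.
rewrite (_ : (fun _ => _) = f k \+ (fun x => \sum_(k <- s) f k x)).
  exact: (algebraD sig_functions_algebra).
by apply/funext => x; rewrite big_cons.
Qed.

Lemma sig_linear_sig_functions N (l : seq 'I_(1 + d) -> R) :
  sig_functions (sig_linear N l).
Proof.
apply: sig_functions_sum => k; apply: sig_functions_sum => I.
exists [:: (l I, rev I)] => //; apply/funext => x.
by rewrite /sig_comb /word_comb big_seq1 sig_coordE.
Qed.

Lemma sum_tuples_pick N (J : seq 'I_(1 + d)) (v : R) : (size J <= N)%N ->
  \sum_(k < N.+1) \sum_(I : k.-tuple 'I_(1 + d)) (if tval I == J then v else 0) = v.
Proof.
rewrite -ltnS => JN; rewrite (bigD1 (Ordinal JN))//= [X in _ + X]big1 ?addr0.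
  rewrite (bigD1 (in_tuple J))//= eqxx [X in _ + X]big1 ?addr0// => I IJ.
  by rewrite ifN//; apply: contra IJ => /eqP IJ; apply/eqP/val_inj.
move=> k kJ; rewrite big1// => I _; rewrite ifN//; apply: contra kJ => /eqP IJ.
by apply/eqP/val_inj; rewrite /= -IJ size_tuple.
Qed.

Lemma sig_comb_sig_linear c : exists N (l : seq 'I_(1 + d) -> R),
  forall x : Lambda p x0 a, sig_linear N l x = sig_comb c x.
Proof.
exists (\max_(w <- c) size w.2), (fun I => \sum_(w <- c) if I == rev w.2 then w.1 else 0).
move=> x; rewrite /sig_linear /sig_comb /word_comb.
set N := \max_(w <- c) _.
have step (k : 'I_N.+1) : \sum_(I : k.-tuple 'I_(1 + d))
      (\sum_(w <- c) if tval I == rev w.2 then w.1 else 0) * sig_coord I x =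
    \sum_(w <- c) \sum_(I : k.-tuple 'I_(1 + d)) if tval I == rev w.2
      then w.1 * iterated_integral (stopped x) w.2 (horizon x) else 0.
  rewrite exchange_big/=; apply: eq_bigr => I _; rewrite mulr_suml.
  apply: eq_bigr => w _; case: eqP => [IJ|_]; last by rewrite mul0r.
  by rewrite sig_coordE IJ revK.
rewrite (eq_bigr _ (fun k _ => step k)) exchange_big/= !big_seq; apply: eq_bigr => w wc.
apply: sum_tuples_pick; rewrite size_rev.
exact: (@leq_bigmax_seq _ _ xpredT (fun w => size w.2)).
Qed.

Lemma weighted_norm_le (f : Lambda p x0 a -> R) (C : R) :
  (forall x, `|f x| <= C * psi x) -> (weighted_norm psi f <= C%:E)%E.
Proof.
move=> fC; apply: ge_ereal_sup => _ [x _ <-].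
by rewrite lee_fin ler_pdivrMr// expR_gt0.
Qed.

(** The approximating bounded functions are truncations at height [L]. Where
    [|s| > L] the error is at most [|s| <= s ^ 2 / L], and [s ^ 2] is again a
    combination of iterated integrals, hence bounded by a multiple of [psi]. *)
Lemma sig_comb_weighted_space c : weighted_space psi (sig_comb c).
Proof.
split.
  have [C HC] := sig_comb_weight_bound c.
  by apply: le_lt_trans (weighted_norm_le HC) _; rewrite ltry.
move=> e e0; have [c2 _ c2E] := algebraM sig_functions_algebra
  (ex_intro2 _ _ c I erefl) (ex_intro2 _ _ c I erefl).
have [C HC] := sig_comb_weight_bound c2.
pose L := 2 * (`|C| + 1) / e.
have L0 : 0 < L by rewrite divr_gt0// mulr_gt0// ltr_wpDl.
pose cl (t : R) := Num.max (- L) (Num.min L t).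
have cc : continuous cl by exact: continuous_clamp.
exists (cl \o sig_comb c); split.
- move=> x; apply: continuous_comp; last exact: cc.
  exact: (sig_comb_continuous (ltW T0)).
- exists L; split=> [|M LM x _ /=]; first exact: num_real.
  rewrite (le_trans _ (ltW LM))// ler_norml /cl le_max lexx ge_max ge_min lexx /=.
  lra.
apply: (@le_lt_trans _ _ (e / 2)%:E); last by rewrite lte_fin; lra.
apply: weighted_norm_le => x /=; set s := sig_comb c x.
have [sL|Ls] := leP `|s| L.
  rewrite (_ : s - cl s = 0) ?normr0 ?mulr_ge0 ?expR_ge0 ?divr_ge0 ?(ltW e0)//.
  by move: sL; rewrite ler_norml /cl => /andP[? ?]; rewrite min_r// max_r// subrr.
have ss : `|s - cl s| <= `|s|.
  rewrite /cl; case: (leP L s) => sL; case: (leP (- L)) => sL';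
  rewrite ?subrr ?normr0//.
  - by rewrite !ger0_norm; lra.
  - lra.
  - by rewrite opprK !ler0_norm; lra.
rewrite (le_trans ss)// -(ler_pM2l L0).
apply: (@le_trans _ _ (`|s| * `|s|)); first by rewrite ler_wpM2r// ltW.
have := HC x; rewrite c2E /= normrM => /le_trans; apply.
have -> : L * (e / 2 * psi x) = (`|C| + 1) * psi x.
  by rewrite /L; field; rewrite gt_eqF.
by rewrite ler_wpM2r ?expR_ge0// (le_trans (ler_norm _))// lerDl.
Qed.

(** If no admissible function separated [x] and [y], the letter of time would
    show that their horizons agree, and the moments that their paths agree. *)
Lemma sig_functions_separate x y : x <> y -> exists2 g, sig_functions g & g x <> g y /\
  exists2 h : R, 0 < h & forall f, sig_functions f ->
    exists C : R, forall z, `|f z| * expR (h * `|g z|) <= C * psi z.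
Proof.
move=> xy; apply: contrapT => nosep.
have same c (C1 C2 : R) : 0 <= C2 ->
    (forall z : Lambda p x0 a, `|sig_comb c z| <= C1 + C2 * path_norm al z) ->
    sig_comb c x = sig_comb c y.
  move=> C20 Hc; apply: contrapT => cxy; apply: nosep; exists (sig_comb c); first by exists c.
  split=> //; have [h h0 H] := sig_comb_exp_growth C20 Hc.
  by exists h => // _ [c' _ <-]; exact: H.
apply: xy; apply: (moment_separates (ltW T0)) => [|i q c Hc].
  have E z : sig_comb [:: (1, [:: time_letter])] z = horizon z.
    rewrite /sig_comb /word_comb big_seq1 mul1r.
    by rewrite (iterated_integral_letter (ltW T0)) ?horizon_itv// !coord_stopped_time subr0.
  have := same [:: (1, [:: time_letter])] T 0 (lexx 0); rewrite !E; apply => z.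
  by rewrite E mul0r addr0; have /andP[? ?] := horizon_itv z; rewrite ger0_norm.
have [C C0 HC] := moment_growth (ltW T0) al Hc.
by apply: (same c 0 C) => // z; rewrite add0r.
Qed.

Lemma sig_comb_dense (f : Lambda p x0 a -> R) : weighted_space psi f ->
  forall e : R, 0 < e -> exists c,
    forall x, `|f x - sig_comb c x| <= e * psi x.
Proof.
move=> [_ Hf] e e0; have e20 : 0 < e / 2 by rewrite divr_gt0.
have [g [cg [M [_ gM]] fg]] := Hf _ e20.
have gB x : `|g x| <= M + 1 by apply: gM => //; rewrite ltrDl.
have [] := @weighted_stone_weierstrass R _ psi sig_functions exp_weight_ge1
  sig_functions_algebra _ _ exp_weight_sublevel_compact sig_functions_separate
  g (M + 1) cg gB (e / 2) e20.
- by move=> _ [c _ <-]; exact: (sig_comb_continuous (ltW T0)).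
- by move=> _ [c _ <-]; exact: sig_comb_weight_bound.
move=> _ [c _ <-] gc; exists c => // x.
rewrite -(subrK (g x) (f x)) -addrA (le_trans (ler_normD _ _))// (splitr e) mulrDl.
rewrite lerD// -ler_pdivrMr ?expR_gt0// -lee_fin.
by apply: le_trans (ltW fg); apply: ereal_sup_ubound; exists x.
Qed.

End weighted_signature.

Theorem proposition3p3 (R : realType) (T : R) (hT : 0 < T)
    (d : nat) (hd : (0 < d)%N) (x0 : 'rV[R]_d) (p : time_partition T)
    (alpha' : {i01 R}) (alpha beta gamma : R)
    (halpha : alpha'%:num < alpha) (halpha1 : alpha <= 1)
    (hbeta : 0 < beta) (hgamma : 1 <= gamma) :
  let psi : Lambda p x0 alpha' -> R := exp_weight alpha beta gamma in
  [/\ admissible_weight psi,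
      (forall (N : nat) (l : seq 'I_(1 + d) -> R),
         weighted_space psi (sig_linear N l)) &
      forall f : Lambda p x0 alpha' -> R, weighted_space psi f ->
      forall e : R, 0 < e ->
      exists (N : nat) (l : seq 'I_(1 + d) -> R),
        (ereal_sup (range (fun x => (`|f x - sig_linear N l x| / psi x)%:E))
           < e%:E)%E].
Proof.
move=> psi; have alpha0 : 0 <= alpha by rewrite ltW// (le_lt_trans _ halpha).
have [al alE] : exists al : {i01 R}, al%:num = alpha by exists (Itv01 alpha0 halpha1).
rewrite {}/psi; case: _ / alE in halpha *.
split.
- exact: exp_weight_admissible.
- move=> N l; have [c _ <-] := sig_linear_sig_functions hT (p := p) (x0 := x0) (a := alpha') N l.
  exact: sig_comb_weighted_space.
move=> f Hf e e0; have e20 : 0 < e / 2 by rewrite divr_gt0.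
have [c Hc] := sig_comb_dense hT halpha hbeta hgamma Hf e20.
have [N [l Hl]] := sig_comb_sig_linear (p := p) (x0 := x0) (a := alpha') c.
exists N, l; apply: (@le_lt_trans _ _ (e / 2)%:E); last by rewrite lte_fin; lra.
apply: ge_ereal_sup => _ [x _ <-].
by rewrite lee_fin ler_pdivrMr ?expR_gt0// Hl.
Qed.
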